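(* Let $\mathcal A\subseteq\mathbb R^s$ be a Borel set with $\lambda^s(\mathcal A)>0$, let $h\colon\mathbb R^s\to\mathbb R^m$ with $s\le m$ be real analytic with $s$-dimensional Jacobian $Jh$ not identically zero, and let $f\colon\mathbb R^m\to\mathbb R^n$ be real analytic. If $f$ is one-to-one on $h(\mathcal A)$, then $n\ge s$.
   Context: For differentiable $h\colon\mathbb R^s\to\mathbb R^m$ with $m\ge s$ and differential $Dh(\mathbf v)\in\mathbb R^{m\times s}$, $Jh(\mathbf v)=\sqrt{\det(Dh(\mathbf v)^TDh(\mathbf v))}$. $\lambda^s$ is Lebesgue measure on $\mathbb R^s$. *)

(* Defs.v *)
From HB Require Import structures.
From mathcomp Require Import all_boot all_order all_algebra.
From mathcomp Require Import all_classical all_reals all_analysis.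
Set Implicit Arguments. Unset Strict Implicit. Unset Printing Implicit Defensive.
Import Order.TTheory GRing.Theory Num.Theory.
Import numFieldNormedType.Exports.
Local Open Scope classical_set_scope.
Local Open Scope ring_scope.

Section Defs.
Variable R : realType.

Definition borel_set (s : nat) (A : set 'rV[R]_s) : Prop :=
  <<s [set U : set 'rV[R]_s | open U] >> A.

Definition box (s : nat) (a b : 'rV[R]_s) : set 'rV[R]_s :=
  [set x | forall i, a 0 i <= x 0 i <= b 0 i].
Definition box_vol (s : nat) (a b : 'rV[R]_s) : R :=
  \prod_(i < s) Num.max 0 (b 0 i - a 0 i).

(* s-dimensional Lebesgue (outer) measure: infimum of total volumes of
   countable covers by closed boxes.  On Borel sets this is lambda^s. *)
Definition lebesgue_outer (s : nat) (A : set 'rV[R]_s) : \bar R :=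
  ereal_inf [set (\sum_(0 <= k <oo) (box_vol (ab k).1 (ab k).2)%:E)%E
            | ab in [set ab : nat -> 'rV[R]_s * 'rV[R]_s |
                     A `<=` \bigcup_k box (ab k).1 (ab k).2]].

Definition mono (s : nat) (alpha : 'I_s -> nat) (x0 x : 'rV[R]_s) : R :=
  \prod_(i < s) (x 0 i - x0 0 i) ^+ alpha i.
Definition psum (s : nat) (c : ('I_s -> nat) -> R) (x0 x : 'rV[R]_s) (N : nat) : R :=
  \sum_(alpha : {ffun 'I_s -> 'I_N}) c (fun i => nat_of_ord (alpha i)) *
                                     mono (fun i => nat_of_ord (alpha i)) x0 x.
Definition pabssum (s : nat) (c : ('I_s -> nat) -> R) (x0 x : 'rV[R]_s) (N : nat) : R :=
  \sum_(alpha : {ffun 'I_s -> 'I_N}) `|c (fun i => nat_of_ord (alpha i)) *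
                                     mono (fun i => nat_of_ord (alpha i)) x0 x|.

Definition real_analytic_scalar (s : nat) (g : 'rV[R]_s -> R) : Prop :=
  forall x0 : 'rV[R]_s, exists c : ('I_s -> nat) -> R, exists2 r : R, 0 < r &
    forall x, ball x0 r x ->
      (exists M : R, forall N, pabssum c x0 x N <= M) /\
      psum c x0 x @ \oo --> g x.

Definition real_analytic (s m : nat) (h : 'rV[R]_s -> 'rV[R]_m) : Prop :=
  forall i : 'I_m, real_analytic_scalar (fun x => h x 0 i).

Definition Dmat (s m : nat) (h : 'rV[R]_s -> 'rV[R]_m) (v : 'rV[R]_s) : 'M[R]_(m, s) :=
  \matrix_(i < m, j < s) ('D_(delta_mx 0 j) h v) 0 i.

Definition Jac (s m : nat) (h : 'rV[R]_s -> 'rV[R]_m) (v : 'rV[R]_s) : R :=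
  Num.sqrt (\det ((Dmat h v)^T *m Dmat h v)).

End Defs.

(* Main.v *)
Require Import Defs.
From HB Require Import structures.
From mathcomp Require Import all_boot all_order all_algebra.
From mathcomp Require Import all_classical all_reals all_analysis.
From mathcomp Require Import ring lra.
Import Order.TTheory GRing.Theory Num.Theory.
Import numFieldNormedType.Exports.
Local Open Scope classical_set_scope.
Local Open Scope ring_scope.
Set Implicit Arguments.
Unset Strict Implicit.
Unset Printing Implicit Defensive.

(** Suppose [n < s] and put [g = f \o h]. Let [r <= n] be the maximal rank of the
    differential [J] of [g], and choose [B], [U] such that [B *m J *m U] is
    an invertible [r] by [r] matrix somewhere. Its determinant and the Gram
    determinant of [h] are analytic along every line, hence vanish only on a
    null set. Near any other point [p] the map [h] is injective and [J] has
    constant rank [r], so [x |-> x - x *m (J p *m U *m B) + g x *m U *m B] is a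
    bilipschitz chart in which [g] is constant along a fixed direction [k != 0].
    If [g] separates the points of [A], the translates of the image of [A] by
    multiples of [k] are therefore pairwise disjoint; being Borel, bounded and of
    equal measure, they are null, and so is [A] near [p].

    Sets of measure zero are always obtained from such a packing of disjoint
    translates or dilates, which replaces Fubini's theorem. Analyticity enters
    through power series in one variable along curves: the series with a given
    bound on the sum of their coefficients are closed under pointwise limits,
    which yields products, compositions and partial derivatives. *)

(** * Power series in one variable *)

(** The set [A] may have empty interior, so topological obstructions such as invariance of domain do
    not apply; only its positive measure can be contradicted. Taking the maximal rank is what makes
    the rank locally constant: a nonvanishing minor bounds it from below nearby, maximality bounds
    it from above. The hypothesis on [f] identifies only [h x] with [h y]; the Gram determinant is
    what then gives [x = y] on small balls. Working with multi-index series directly would require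
    rearranging multiple sums; curves with a uniform norm bound reduce every such manipulation to
    one variable. *)

Section OneVariable.
Variable R : realType.
Implicit Types (u v : R -> R) (a b : nat -> R) (d M t : R).

(* [u] is the sum of the series with coefficients [a], of weighted norm at most
   [M]. Convergence is expressed by tail bounds, which are stable under pointwise
   limits. *)
Definition ps_at d M a u :=
  [/\ 0 < d, forall K, \sum_(k < K) `|a k| * d ^+ k <= M &
  forall t K, `|t| < d ->
     `|u t - \sum_(k < K) a k * t ^+ k| <= M * (`|t| / d) ^+ K].

Definition ps d M u := exists a, ps_at d M a u.

Lemma ps_at_ge0 d M a u : ps_at d M a u -> 0 <= M.
Proof. by move=> [_ /(_ 0%N) + _]; rewrite big_ord0. Qed.

Lemma ps_ge0 d M u : ps d M u -> 0 <= M.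
Proof. by move=> [a /ps_at_ge0]. Qed.

Lemma ps_gt0 d M u : ps d M u -> 0 < d.
Proof. by move=> [a []]. Qed.

Lemma ps_bound d M u t : ps d M u -> `|t| < d -> `|u t| <= M.
Proof.
by move=> [a [_ _ /(_ t 0%N) +]] td => /(_ td); rewrite big_ord0 subr0 expr0 mulr1.
Qed.

Lemma ps_at0 d M a u : ps_at d M a u -> a 0%N = u 0.
Proof.
move=> [d0 _ /(_ 0 1%N)]; rewrite normr0 => /(_ d0).
rewrite big_ord1 expr0 mulr1 mul0r expr1 mulr0 normr_le0 subr_eq0.
by move/eqP.
Qed.

Lemma ps_ext d M u v : (forall t, `|t| < d -> u t = v t) -> ps d M u -> ps d M v.
Proof.
move=> uv [a [d0 a1 a2]]; exists a; split=> // t K td.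
by rewrite -uv//; exact: a2.
Qed.

Lemma ps_weaken d M M' u : M <= M' -> ps d M u -> ps d M' u.
Proof.
move=> MM' [a [d0 a1 a2]]; exists a; split=> // [K|t K td].
  exact: le_trans (a1 K) MM'.
apply: le_trans (a2 t K td) _; rewrite ler_wpM2r// exprn_ge0// divr_ge0//.
exact: ltW.
Qed.

Lemma ps_shrink d d' M u : 0 < d' -> d' <= d -> ps d M u -> ps d' M u.
Proof.
move=> d'0 dd' [a au]; exists a; have M0 := ps_at_ge0 au; case: au => d0 a1 a2.
split=> // [K|t K td].
  apply: le_trans (a1 K); apply: ler_sum => k _.
  by rewrite ler_wpM2l// lerXn2r// nnegrE ltW.
apply: le_trans (a2 t K (lt_le_trans td dd')) _.
rewrite ler_wpM2l// lerXn2r ?nnegrE ?divr_ge0// ?(ltW d0) ?(ltW d'0)//.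
by rewrite ler_wpM2l// lef_pV2.
Qed.

(** An analogue of the Schwarz lemma: the constant coefficient vanishes, so every remaining term
    gains a factor [d' / d]. Shrinking [d'] makes the norm as small as a composition requires. *)
Lemma ps_small d d' M u : 0 < d' -> d' <= d -> u 0 = 0 -> ps d M u ->
  ps d' (M * (d' / d)) u.
Proof.
move=> d'0 dd' u0 [a au]; have M0 := ps_at_ge0 au.
have d0 : 0 < d by exact: lt_le_trans dd'.
have a0 : a 0%N = 0 by rewrite (ps_at0 au).
have q0 : 0 <= d' / d by rewrite divr_ge0 ?ltW.
have q1 : d' / d <= 1 by rewrite ler_pdivrMr// mul1r.
case: au => _ a1 a2; exists a; split=> // [K|t K td].
  apply: (@le_trans _ _ (\sum_(k < K) (`|a k| * d ^+ k) * (d' / d))).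
    apply: ler_sum => -[[|k] kK] _ /=; first by rewrite a0 normr0 !mul0r.
    have -> : d' ^+ k.+1 = d ^+ k.+1 * (d' / d) ^+ k.+1.
      by rewrite -exprMn mulrCA divff ?mulr1// gt_eqF.
    rewrite mulrA ler_wpM2l ?mulr_ge0 ?exprn_ge0 ?(ltW d0)//.
    by rewrite exprS -[leRHS]mulr1 ler_wpM2l// exprn_ile1.
  by rewrite -mulr_suml ler_wpM2r.
have td' := lt_le_trans td dd'.
case: K => [|K].
  have := a2 t 1%N td'; rewrite big_ord1 a0 mul0r big_ord0 expr1 expr0 mulr1.
  move=> /le_trans; apply; rewrite ler_wpM2l// ler_wpM2r ?invr_ge0 ?(ltW d0)//.
  exact: ltW.
apply: le_trans (a2 t K.+1 td') _.
have -> : `|t| / d = (`|t| / d') * (d' / d).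
  by rewrite mulrA divfK// gt_eqF.
rewrite exprMn -mulrA ler_wpM2l// mulrC ler_wpM2r//.
  by rewrite exprn_ge0// divr_ge0// ltW.
by rewrite exprS -[leRHS]mulr1 ler_wpM2l// exprn_ile1.
Qed.

Lemma ps_cst d c : 0 < d -> ps d `|c| (fun=> c).
Proof.
move=> d0; exists (fun k => if k is 0 then c else 0); split=> // [[|K]|t [|K] td].
- by rewrite big_ord0.
- rewrite big_ord_recl expr0 mulr1 big1 ?addr0// => i _.
  by rewrite /= normr0 mul0r.
- by rewrite big_ord0 subr0 expr0 mulr1.
- rewrite big_ord_recl expr0 mulr1 big1 ?addr0 => [|i _]; last first.
    by rewrite /bump/= mul0r.
  by rewrite subrr normr0 mulr_ge0// exprn_ge0// divr_ge0// ltW.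
Qed.

Lemma ps_add d M M' u v : ps d M u -> ps d M' v ->
  ps d (M + M') (fun t => u t + v t).
Proof.
move=> [a [d0 a1 a2]] [b [_ b1 b2]]; exists (fun k => a k + b k).
split=> // [K|t K td].
  apply: le_trans (lerD (a1 K) (b1 K)); rewrite -big_split; apply: ler_sum => k _.
  by rewrite /= -mulrDl ler_wpM2r ?ler_normD// exprn_ge0// ltW.
rewrite mulrDl.
have -> : u t + v t - \sum_(k < K) (a k + b k) * t ^+ k =
  (u t - \sum_(k < K) a k * t ^+ k) + (v t - \sum_(k < K) b k * t ^+ k).
  under eq_bigr do rewrite mulrDl.
  by rewrite big_split /=; ring.
by apply: le_trans (ler_normD _ _) _; apply: lerD; [exact: a2|exact: b2].
Qed.

Lemma ps_scale d M c u : ps d M u -> ps d (`|c| * M) (fun t => c * u t).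
Proof.
move=> [a [d0 a1 a2]]; exists (fun k => c * a k); split=> // [K|t K td].
  under eq_bigr do rewrite normrM -mulrA.
  by rewrite -mulr_sumr ler_wpM2l.
under eq_bigr do rewrite -mulrA.
by rewrite -mulr_sumr -mulrBr normrM -mulrA ler_wpM2l// a2.
Qed.

Lemma ps_mulX d M u : ps d M u -> ps d (M * d) (fun t => u t * t).
Proof.
move=> pu; have M0 := ps_ge0 pu; case: pu => a [d0 a1 a2].
exists (fun k => if k is k'.+1 then a k' else 0); split=> // [[|K]|t [|K] td].
- by rewrite big_ord0 mulr_ge0// ltW.
- rewrite big_ord_recl normr0 mul0r add0r.
  under eq_bigr do rewrite /= exprSr mulrA.
  by rewrite -mulr_suml ler_wpM2r// ltW.
- have := a2 t 0%N td; rewrite !big_ord0 !subr0 !expr0 !mulr1 normrM => h.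
  by rewrite ler_pM// ltW.
- rewrite big_ord_recl mul0r add0r.
  under eq_bigr do rewrite /= exprSr mulrA.
  rewrite -mulr_suml -mulrBl normrM exprSr.
  have -> : M * d * ((`|t| / d) ^+ K * (`|t| / d)) = M * (`|t| / d) ^+ K * `|t|.
    by field; rewrite gt_eqF.
  by rewrite ler_wpM2r// a2.
Qed.

Lemma ps_mulXn d M u n : ps d M u -> ps d (M * d ^+ n) (fun t => u t * t ^+ n).
Proof.
elim: n M u => [|n ih] M u pu.
  by rewrite expr0 mulr1; apply: ps_ext pu => t _; rewrite expr0 mulr1.
have := ih _ _ (ps_mulX pu); rewrite -mulrA -exprS; apply: ps_ext => t _.
by rewrite -mulrA -exprS.
Qed.

Lemma ps_sum (I : finType) d (M : I -> R) (u : I -> R -> R) : 0 < d ->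
  (forall i, ps d (M i) (u i)) -> ps d (\sum_i M i) (fun t => \sum_i u i t).
Proof.
move=> d0 pu.
have -> : (fun t => \sum_i u i t) = \sum_i u i by rewrite funeqE => t; rewrite fct_sumE.
elim/big_ind2 : _ => [|x1 x2 y1 y2 h1 h2|i _]; last exact: pu.
  by rewrite -(normr0 R); exact: ps_cst.
exact: ps_add.
Qed.

Lemma fmap_ultra (T U : Type) (f : T -> U) (F : set_system T) :
  UltraFilter F -> UltraFilter (f @ F).
Proof.
move=> UF; split=> [|G PG FG]; first exact: fmap_proper_filter.
rewrite predeqE => A; split=> [GA|]; last exact: FG.
have [//|FnA] := in_ultra_setVsetC (f @^-1` A) UF.
have GnA : G (~` A) by apply: FG.
by have /filter_ex [? []] : G (A `&` ~` A) by exact: filterI.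
Qed.

Lemma ultra_bounded_cvg (F : set_system nat) (x : nat -> R) B :
  UltraFilter F -> (forall j, `|x j| <= B) -> exists l : R, x j @[j --> F] --> l.
Proof.
move=> UF xB.
have UxF : UltraFilter (x @ F) by exact: fmap_ultra.
have FB : (x @ F) `[- B, B]%classic.
  have PF : ProperFilter F := ultra_proper.
  by apply: nearW => j; rewrite /= in_itv/= -ler_norml.
have := @segment_compact R (- B) B.
by rewrite compact_ultra => /(_ (x @ F) UxF FB) [l [_ xl]]; exists l.
Qed.

(* The coefficients of a bounded family of power series live in a compact
   set, so they converge along an ultrafilter, and the uniform tail estimate
   survives in the limit. *)
Lemma ps_at_ultra (F : set_system nat) d M (a : nat -> nat -> R)
    (u : nat -> R -> R) (v : R -> R) : UltraFilter F ->
  (forall j, ps_at d M (a j) (u j)) ->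
  (forall t, `|t| < d -> u j t @[j --> F] --> v t) ->
  exists b : nat -> R, (forall k, a j k @[j --> F] --> b k) /\ ps_at d M b v.
Proof.
move=> UF pa uv; have d0 : 0 < d by case: (pa 0%N).
have PF : ProperFilter F by exact: ultra_proper.
have /choice [b ab] : forall k, exists l : R, a j k @[j --> F] --> l.
  move=> k; apply: (@ultra_bounded_cvg F _ (M / d ^+ k)) => // j.
  rewrite ler_pdivlMr ?exprn_gt0//; case: (pa j) => _ /(_ k.+1) + _.
  rewrite big_ord_recr/=; apply: le_trans; rewrite lerDr sumr_ge0// => i _.
  by rewrite mulr_ge0// exprn_ge0// ltW.
exists b; split=> //; split=> // [K|t K td].
  apply: (@cvgr_to_le _ F _ _ (fun j => \sum_(k < K) `|a j k| * d ^+ k)).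
    apply: cvg_big => [|k _]; first exact: add_continuous.
    by apply: cvgM; [exact: cvg_norm|exact: cvg_cst].
  by apply: nearW => j; case: (pa j) => _ + _; apply.
apply: (@cvgr_to_le _ F _ _ (fun j => `|u j t - \sum_(k < K) a j k * t ^+ k|)).
  apply: cvg_norm; apply: cvgB; first exact: uv.
  apply: cvg_big => [|k _]; first exact: add_continuous.
  by apply: cvgM; [exact: ab|exact: cvg_cst].
by apply: nearW => j; case: (pa j) => _ _; apply.
Qed.

Lemma ultra_ooP : exists F : set_system nat, UltraFilter F /\ F --> \oo.
Proof. exact: ultraFilterLemma. Qed.

Lemma ps_lim d M (u : nat -> R -> R) v : (forall j, ps d M (u j)) ->
  (forall t, `|t| < d -> u j t @[j --> \oo] --> v t) -> ps d M v.
Proof.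
move=> /choice[a pa] uv; have [F [UF Foo]] := ultra_ooP.
have [t td|b [_ pb]] := ps_at_ultra UF pa (v := v); last by exists b.
exact: cvg_trans (cvg_app _ Foo) (uv t td).
Qed.

Lemma ps_at_cvg d M a u t : ps_at d M a u -> `|t| < d ->
  \sum_(k < K) a k * t ^+ k @[K --> \oo] --> u t.
Proof.
move=> [d0 _ a2] td; apply/cvgrPdist_le => e e0.
have q1 : `| `|t| / d | < 1 by rewrite ger0_norm ?divr_ge0 ?(ltW d0)// ltr_pdivrMr// mul1r.
have := cvg_geometric M q1 => /cvgr0Pnorm_le /(_ e e0); apply: filterS => K /=.
move=> h; apply: le_trans (a2 t K td) _; exact: le_trans (ler_norm _) h.
Qed.

(** The products of [u] with the partial sums of [v] have norm at most [M * M'], and [ps_lim] passes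
    to the limit; no Cauchy product is formed. *)
Lemma ps_mul d M M' u v : ps d M u -> ps d M' v -> ps d (M * M') (fun t => u t * v t).
Proof.
move=> pu [b pb]; have M0 := ps_ge0 pu; have d0 := ps_gt0 pu.
apply: (@ps_lim _ _ (fun K t => \sum_(k < K) b k * (u t * t ^+ k))) => [K|t td].
  apply: (@ps_weaken _ (\sum_(k < K) `|b k| * (M * d ^+ k))).
    under eq_bigr do rewrite mulrCA.
    by rewrite -mulr_sumr ler_wpM2l//; case: pb.
  by apply: ps_sum => // k; apply: ps_scale; exact: ps_mulXn.
have -> : (fun K => \sum_(k < K) b k * (u t * t ^+ k)) =
          (fun K => u t * \sum_(k < K) b k * t ^+ k).
  by apply/funext => K; rewrite mulr_sumr; apply: eq_bigr => k _; rewrite mulrCA.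
by apply: cvgM; [exact: cvg_cst|exact: ps_at_cvg pb td].
Qed.

Lemma ps_exp d M u n : ps d M u -> ps d (M ^+ n) (fun t => u t ^+ n).
Proof.
move=> pu; elim: n => [|n ih].
  by rewrite expr0 -(normr1 R); apply: ps_ext (ps_cst 1 (ps_gt0 pu)) => t _; rewrite expr0.
by rewrite exprS; apply: ps_ext (ps_mul pu ih) => t _; rewrite exprS.
Qed.

Lemma ps_prod (I : finType) d (M : I -> R) (u : I -> R -> R) : 0 < d ->
  (forall i, ps d (M i) (u i)) -> ps d (\prod_i M i) (fun t => \prod_i u i t).
Proof.
move=> d0 pu.
have -> : (fun t => \prod_i u i t) = \prod_i u i by rewrite funeqE => t; rewrite fct_prodE.
elim/big_ind2 : _ => [|x1 x2 y1 y2 h1 h2|i _]; last exact: pu.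
  by rewrite -(normr1 R); exact: ps_cst.
exact: ps_mul.
Qed.

Lemma ps_at_taylor1 d M a u t : ps_at d M a u -> `|t| < d ->
  `|u t - u 0 - t * a 1%N| <= M / d ^+ 2 * t ^+ 2.
Proof.
move=> pa td; have := ps_at0 pa; case: pa => d0 _ /(_ t 2%N td) + a0.
rewrite !big_ord_recl big_ord0 /= expr0 mulr1 a0 addr0 /bump/= expr1.
rewrite expr_div_n real_normK ?num_real// mulrA mulrAC.
by have -> : u t - (u 0 + a 1%N * t) = u t - u 0 - t * a 1%N by ring.
Qed.

Lemma ps_lip d M u t : ps d M u -> `|t| < d -> `|u t - u 0| <= M / d * `|t|.
Proof.
move=> [a pa] td; have := ps_at0 pa; case: pa => d0 _ /(_ t 1%N td) + a0.
by rewrite big_ord1 expr0 mulr1 a0 expr1 mulrA mulrAC.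
Qed.

(** Turns second-order bounds, the form in which the tail estimate for [K = 2] arrives, into
    derivatives, also for vector-valued maps. *)
Lemma is_derive_quad (V : normedModType R) (W : normedModType R) (f : V -> W)
    (x w : V) (c : W) d K : 0 < d ->
  (forall t, `|t| < d -> `|f (t *: w + x) - f x - t *: c| <= K * t ^+ 2) ->
  is_derive x w f c.
Proof.
move=> d0 fK.
have K0 : 0 <= K.
  have hd : `|d / 2| < d by rewrite ger0_norm; lra.
  have := le_trans (normr_ge0 _) (fK _ hd).
  by rewrite pmulr_lge0// exprn_gt0//; lra.
have h : t^-1 *: ((f \o shift x) (t *: w) - f x) @[t --> (0:R)^'] --> c.
  apply/cvgrPdist_le => e e0; near=> t.
  have t0 : t != 0 by near: t; exact: nbhs_dnbhs_neq.
  have -> : c - t^-1 *: ((f \o shift x) (t *: w) - f x) =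
      - (t^-1 *: (f (t *: w + x) - f x - t *: c)).
    by rewrite /= [in RHS]scalerBr scalerA mulVf// scale1r opprB.
  have te : `|t| < Num.min d (e / (K + 1)).
    near: t; apply: dnbhs0_lt; rewrite lt_min d0/= divr_gt0//; lra.
  move: te; rewrite lt_min => /andP[td te].
  rewrite normrN normrZ normfV ler_pdivrMl ?normr_gt0//.
  apply: le_trans (fK t td) _.
  rewrite -[t ^+ 2]real_normK ?num_real// expr2 mulrCA ler_wpM2l//.
  have : `|t| * (K + 1) <= e by rewrite -ler_pdivlMr ?ltW//; lra.
  by apply: le_trans; rewrite mulrC ler_wpM2l//; lra.
by split; [apply/cvg_ex; exists c|apply: cvg_lim h].
Unshelve. all: by end_near. Qed.

Lemma ps_at_is_derive d M a u : ps_at d M a u -> is_derive (0 : R) (1 : R) u (a 1%N).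
Proof.
move=> pa; have d0 : 0 < d by case: pa.
apply: (@is_derive_quad R^o R^o u _ _ _ d (M / d ^+ 2) d0) => t td.
have := ps_at_taylor1 pa td.
by rewrite addr0 /GRing.scale/= mulr1.
Qed.

(** If [a k] is the first nonzero coefficient, its term dominates the tail of order [k.+1] for small
    nonzero [t]. *)
Lemma ps_isolated d M u : ps d M u ->
  (exists2 e, 0 < e & forall t, `|t| < e -> u t = 0) \/
  (exists2 e, 0 < e & forall t, 0 < `|t| -> `|t| < e -> u t != 0).
Proof.
move=> [a pa]; have M0 := ps_at_ge0 pa; have d0 : 0 < d by case: pa.
have [a0|/existsNP[k0 /eqP ak0]] := pselect (forall k, a k = 0).
  left; exists d => // t td.
  apply/esym; apply: cvg_unique (ps_at_cvg pa td) => //.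
  apply: cvg_near_cst; apply: nearW => K.
  by rewrite big1// => i _; rewrite a0 mul0r.
right; have [k ak kmin] := ex_minnP (ex_intro (fun k => a k != 0) k0 ak0).
have ak_gt0 : 0 < `|a k| by rewrite normr_gt0.
(* At a zero [t] the tail bound reads |a_k| |t|^k <= M (|t|/d)^(k+1), which fails once |t| < |a_k|
   d^(k+1) / M. Using [M + 1] keeps the denominator visibly positive. *)
exists (Num.min d (`|a k| * d ^+ k.+1 / (M + 1))).
  rewrite lt_min d0/= divr_gt0 ?mulr_gt0 ?exprn_gt0//; lra.
move=> t t0; rewrite lt_min => /andP[td te]; apply/eqP => ut.
case: pa => _ _ /(_ t k.+1 td); rewrite ut sub0r normrN big_ord_recr/= big1 => [|i _].
  rewrite add0r normrM normrX expr_div_n mulrA ler_pdivlMr ?exprn_gt0//.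
  rewrite [`|t| ^+ k.+1]exprS mulrA mulrAC ler_pM2r ?exprn_gt0//.
  move: te; rewrite ltr_pdivlMr; last by lra.
  move=> h1 h2; have := lt_le_trans h1 h2; lra.
apply/eqP; rewrite mulf_eq0; apply/orP; left; apply/negPn/negP => /kmin.
by rewrite leqNgt ltn_ord.
Qed.

Definition analytic1 u := forall t0, exists d M, ps d M (fun t => u (t0 + t)).

(** Identity theorem on the connected line: the points near which [u] vanishes form an open and
    closed set, and [t1] lies outside it. *)
Lemma analytic1_isolated u t1 : analytic1 u -> u t1 != 0 -> forall t0,
  exists2 e, 0 < e & forall t, 0 < `|t| -> `|t| < e -> u (t0 + t) != 0.
Proof.
move=> lu ut1 t0; have [d [M /ps_isolated [[e e0 ue]|//]]] := lu t0.
pose S := [set x | exists2 e, 0 < e & forall t, `|t| < e -> u (x + t) = 0].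
have Sopen : open S.
  rewrite openE => x [r r0 ur]; apply/nbhs_ballP; exists (r / 2); first by rewrite /=; lra.
  move=> y; rewrite /ball/= => xy; exists (r / 2) => [|t tr]; first lra.
  have -> : y + t = x + (y - x + t) by ring.
  apply: ur; apply: le_lt_trans (ler_normD _ _) _; rewrite distrC; lra.
(* Around a point outside [S] the zeros are isolated, so no nearby point can have a whole
   neighbourhood of zeros. *)
have SCopen : open (~` S).
  rewrite openE => x Sx; have [r [N /ps_isolated [//|[r' r'0 ur]]]] := lu x.
  apply/nbhs_ballP; exists r' => // y; rewrite /ball/= => xy [r2 r20 uy].
  have [yx|yx] := eqVneq y x; first by apply: Sx; rewrite -yx; exists r2.
  have := ur (y - x); rewrite normr_gt0 subr_eq0 yx distrC xy => /(_ isT isT).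
  have := uy 0; rewrite normr0 addr0 => /(_ r20).
  by rewrite addrCA subrr addr0 => ->; rewrite eqxx.
have : connected [set: R] by apply/connected_intervalP.
move=> /(_ S) H; have ST : S = setT.
  apply: H; first by exists t0; exists e.
    by exists S => //; rewrite setTI.
  by exists S => //; [rewrite -[S]setCK closedC|rewrite setTI].
have : S t1 by rewrite ST.
by move=> [r r0 /(_ 0)]; rewrite normr0 addr0 => /(_ r0) u0; rewrite u0 eqxx in ut1.
Qed.

End OneVariable.

(** * Analytic functions of several variables *)

Section RowNorm.
Variables (R : realType) (n : nat).
Implicit Types x y : 'rV[R]_n.

Lemma rV_coord_le x i : `|x 0 i| <= `|x|.
Proof.
rewrite [leRHS]/Num.norm/= mx_normrE.
by apply/bigmax_geP; right => /=; exists (0, i).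
Qed.

Lemma rV_norm_le x c : 0 <= c -> (forall i, `|x 0 i| <= c) -> `|x| <= c.
Proof.
move=> c0 xc; rewrite [leLHS]/Num.norm/= mx_normrE.
by apply/bigmax_leP; split=> // -[i j] _ /=; rewrite ord1.
Qed.

Lemma rV_ballE x e y : ball x e y <-> `|y - x| < e.
Proof. by rewrite mx_norm_ball /ball_/= distrC. Qed.

End RowNorm.

(** * Multiple power series along curves and their termwise derivatives *)

Section Multivariate.
Variables (R : realType) (s : nat).
Implicit Types (G : 'rV[R]_s -> R) (x y : 'rV[R]_s) (d M rho : R).

Definition unit_row l : 'rV[R]_s := delta_mx 0 l.
Definition pd G l x : R := 'D_(unit_row l) G x.

(** The formal partial derivative of [mono]. For [alpha l = 0] the truncated predecessor is harmless
    because of the factor [(alpha l)%:R]. *)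
Definition dmono (alpha : 'I_s -> nat) l x0 x : R :=
  ((alpha l)%:R * (x 0 l - x0 0 l) ^+ (alpha l).-1) *
  \prod_(i < s | i != l) (x 0 i - x0 0 i) ^+ alpha i.

Definition dpsum (c : ('I_s -> nat) -> R) l x0 x (N : nat) : R :=
  \sum_(alpha : {ffun 'I_s -> 'I_N}) c (fun i => nat_of_ord (alpha i)) *
                                     dmono (fun i => nat_of_ord (alpha i)) l x0 x.

Lemma fct_fsumE (I : finType) (f : I -> R -> R) :
  (fun t => \sum_i f i t) = \sum_i f i.
Proof. by rewrite funeqE => t; rewrite fct_sumE. Qed.

Lemma is_derive_fsum (I : finType) (f : I -> R -> R) (df : I -> R) (t : R) :
  (forall i, is_derive t (1 : R) (f i) (df i)) ->
  is_derive t (1 : R) (fun t => \sum_i f i t) (\sum_i df i).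
Proof.
move=> fdf; rewrite fct_fsumE; elim/big_ind2 : _ => [|f1 d1 f2 d2 h1 h2|i _].
- exact: is_derive_cst.
- exact: is_deriveD.
- exact: fdf.
Qed.

Lemma unit_rowE l (t : R) x i : (t *: unit_row l + x) 0 i = t * (i == l)%:R + x 0 i.
Proof. by rewrite !mxE eqxx. Qed.

Lemma is_derive_mono alpha l x0 x :
  is_derive (0 : R) (1 : R) (fun t => mono alpha x0 (t *: unit_row l + x))
    (dmono alpha l x0 x).
Proof.
set P := \prod_(i < s | i != l) (x 0 i - x0 0 i) ^+ alpha i.
have -> : (fun t => mono alpha x0 (t *: unit_row l + x)) =
  P \*: ((@idfun R + cst (x 0 l - x0 0 l)) ^+ alpha l).
  rewrite funeqE => t; rewrite /mono (bigD1 l)//= unit_rowE eqxx mulr1 -addrA mulrC.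
  rewrite /P /= /GRing.scale/=; congr (_ * _); last by rewrite fctE/=.
  by apply: eq_bigr => i il; rewrite unit_rowE (negbTE il) mulr0 add0r.
apply: is_derive_eq; rewrite /dmono -/P /GRing.scale/= addr0 mulr1 mulrC.
by rewrite !fctE/= add0r.
Qed.

Lemma is_derive_psum c l x0 x N :
  is_derive (0 : R) (1 : R) (fun t => psum c x0 (t *: unit_row l + x) N)
    (dpsum c l x0 x N).
Proof.
apply: is_derive_fsum => alpha.
exact: (@is_deriveZ _ _ _ _ _ _ _ _ (is_derive_mono _ _ _ _)).
Qed.

Lemma ps_mono alpha x0 d rho (g : R -> 'rV[R]_s) : 0 < d ->
  (forall i, ps d rho (fun t => g t 0 i - x0 0 i)) ->
  ps d (\prod_(i < s) rho ^+ alpha i) (fun t => mono alpha x0 (g t)).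
Proof. by move=> d0 pg; apply: ps_prod => // i; apply: ps_exp. Qed.

Lemma ps_psum c x0 d rho M (g : R -> 'rV[R]_s) N : 0 < d -> 0 <= rho ->
  (forall i, ps d rho (fun t => g t 0 i - x0 0 i)) ->
  pabssum c x0 (const_mx rho + x0) N <= M ->
  ps d M (fun t => psum c x0 (g t) N).
Proof.
move=> d0 r0 pg cM; apply: ps_weaken cM _; apply: ps_sum => // alpha.
rewrite normrM; apply: ps_scale; rewrite ger0_norm; last first.
  by apply: prodr_ge0 => i _; rewrite !mxE addrK exprn_ge0.
apply: ps_weaken (ps_mono _ d0 pg); apply: ler_prod => i _.
by rewrite !mxE addrK lexx exprn_ge0.
Qed.

Lemma natr_le_expr2 n : n%:R <= 2 ^+ n :> R.
Proof. by rewrite -natrX ler_nat ltnW// ltn_expl. Qed.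

(** A crude Cauchy estimate: since n <= 2^n, the exponent brought down by differentiation is
    absorbed by doubling the radius, at the price of [rho^-1]. *)
Lemma ps_dmono alpha l x0 d rho (g : R -> 'rV[R]_s) : 0 < d -> 0 < rho ->
  (forall i, ps d rho (fun t => g t 0 i - x0 0 i)) ->
  ps d (rho^-1 * \prod_(i < s) (2 * rho) ^+ alpha i)
    (fun t => dmono alpha l x0 (g t)).
Proof.
move=> d0 r0 pg.
rewrite (bigD1 l)//= mulrA.
apply: (@ps_weaken _ _ (((alpha l)%:R * rho ^+ (alpha l).-1) *
   \prod_(i < s) (if i == l then 1 else rho ^+ alpha i))).
  apply: ler_pM.
  - by rewrite mulr_ge0// exprn_ge0// ltW.
  - by apply: prodr_ge0 => i _; case: eqP => // _; rewrite exprn_ge0// ltW.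
  - case: (alpha l) => [|k].
      by rewrite mul0r mulr_ge0 ?invr_ge0 ?exprn_ge0 ?mulr_ge0// ltW.
    have -> : rho^-1 * (2 * rho) ^+ k.+1 = 2 ^+ k.+1 * rho ^+ k.
      by rewrite exprMn [rho ^+ k.+1]exprS; field; rewrite gt_eqF.
    by rewrite ler_wpM2r ?natr_le_expr2// exprn_ge0// ltW.
  - rewrite (bigD1 l)//= eqxx mul1r; apply: ler_prod => i /negbTE ->.
    apply/andP; split; first by rewrite exprn_ge0// ltW.
    by apply: lerXn2r; rewrite ?nnegrE; lra.
apply: ps_mul.
  rewrite -[X in ps _ (X * _)](ger0_norm (ler0n R (alpha l))).
  by apply: ps_scale; apply: ps_exp.
apply: (@ps_ext _ _ _ (fun t =>
  \prod_(i < s) (if i == l then 1 else (g t 0 i - x0 0 i) ^+ alpha i))).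
  move=> t _; rewrite (bigD1 l)//= eqxx mul1r; apply: eq_bigr => i /negbTE ->//.
apply: ps_prod => // i; case: eqP => _; last exact: ps_exp.
by have := ps_cst 1 d0; rewrite normr1.
Qed.

Lemma ps_dpsum c l x0 d rho M (g : R -> 'rV[R]_s) N : 0 < d -> 0 < rho ->
  (forall i, ps d rho (fun t => g t 0 i - x0 0 i)) ->
  pabssum c x0 (const_mx (2 * rho) + x0) N <= M ->
  ps d (rho^-1 * M) (fun t => dpsum c l x0 (g t) N).
Proof.
move=> d0 r0 pg cM.
apply: (@ps_weaken _ _ (rho^-1 * pabssum c x0 (const_mx (2 * rho) + x0) N)).
  by rewrite ler_wpM2l// invr_ge0 ltW.
rewrite /pabssum mulr_sumr; apply: ps_sum => // alpha.
rewrite normrM mulrCA; apply: ps_scale; rewrite ger0_norm; last first.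
  by apply: prodr_ge0 => i _; rewrite !mxE addrK exprn_ge0// mulr_ge0// ltW.
have := ps_dmono (fun i => nat_of_ord (alpha i)) l d0 r0 pg.
congr (ps d (_ * _)).
by apply: eq_bigr => i _; rewrite !mxE addrK.
Qed.

(** Replaces a multi-index series by its effect on curves that stay, in series norm, in a polydisc
    of radius [rho]. Composition is thereby built into the definition. *)
Definition curve_bound G x0 rho M := forall d (g : R -> 'rV[R]_s), 0 < d ->
  (forall i, ps d rho (fun t => g t 0 i - x0 0 i)) -> ps d M (G \o g).

Lemma ps_affine_coord (x0 x w : 'rV[R]_s) d e i : 0 < d -> `|x - x0| <= e ->
  `|w| <= 1 -> ps d (e + d) (fun t => (t *: w + x) 0 i - x0 0 i).
Proof.
move=> d0 xe w1.
have h1 : ps d e (fun=> x 0 i - x0 0 i).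
  apply: ps_weaken (ps_cst _ d0); apply: le_trans xe.
  by have := rV_coord_le (x - x0) i; rewrite !mxE.
have h2 : ps d d (fun t => t * w 0 i).
  apply: (@ps_weaken _ _ (`|w 0 i| * d)).
    by rewrite -[leRHS]mul1r ler_wpM2r ?(ltW d0)//; exact: le_trans (rV_coord_le _ _) w1.
  by apply: ps_ext (ps_mulX (ps_cst (w 0 i) d0)) => t _; rewrite mulrC.
by apply: ps_ext (ps_add h1 h2) => t _; rewrite !mxE; ring.
Qed.

Lemma unit_row_norm l : `|unit_row l| <= 1.
Proof.
by apply: rV_norm_le => // i; rewrite mxE eqxx/=; case: (i == l); rewrite ?normr1 ?normr0.
Qed.

Lemma analytic_curve G : real_analytic_scalar G -> forall x0, exists rho M,
  [/\ 0 < rho, curve_bound G x0 rho M, forall l, curve_bound (pd G l) x0 rho M &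
      forall l x, `|x - x0| <= rho -> is_derive x (unit_row l) G (pd G l x)].
Proof.
(* [G] is controlled on the polydisc of radius [2 * rho], its partial derivatives on that of radius
   [rho]; both lie in the ball of radius [r]. *)
move=> Ga x0; have [c [r r0 cG]] := Ga x0; pose rho := r / 4.
have rho0 : 0 < rho by rewrite /rho; lra.
have in_ball x : (forall i, `|x 0 i - x0 0 i| <= 2 * rho) -> ball x0 r x.
  move=> h; apply/rV_ballE; apply: (@le_lt_trans _ _ (2 * rho)).
    by apply: rV_norm_le => [|i]; [lra|rewrite !mxE].
  by rewrite /rho; lra.
(* Absolute convergence at one corner of the polydisc bounds the weighted coefficient sums for the
   whole of it. *)
have [M cM] : exists M, forall N, pabssum c x0 (const_mx (2 * rho) + x0) N <= M.
  have [] // := cG (const_mx (2 * rho) + x0).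
  by apply: in_ball => i; rewrite !mxE addrK ger0_norm//; lra.
have M0 : 0 <= M.
  by apply: le_trans (cM 0%N); apply: sumr_ge0.
have Gcvg x : (forall i, `|x 0 i - x0 0 i| <= 2 * rho) ->
    psum c x0 x @ \oo --> G x.
  by move=> /in_ball /cG [].
have CB : curve_bound G x0 (2 * rho) M.
  move=> d g d0 pg; apply: (@ps_lim _ _ _ (fun N t => psum c x0 (g t) N)) => [N|t td].
    apply: ps_psum pg _ => //; lra.
  by apply: Gcvg => i; exact: ps_bound (pg i) td.
have [F [UF Foo]] := ultra_ooP.
have PF : ProperFilter F := ultra_proper.
(* Along a line, the degree-one coefficients of the partial sums converge to that of [G]. This
   identifies the limit of the differentiated sums with the derivative of [G]. *)
have dcvg l x : `|x - x0| <= rho -> exists2 b, is_derive x (unit_row l) G b &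
    dpsum c l x0 x N @[N --> F] --> b.
  move=> xr; have pg i := ps_affine_coord i rho0 xr (unit_row_norm l).
  have /choice[a pa] : forall N, ps rho M (fun t => psum c x0 (t *: unit_row l + x) N).
    move=> N; apply: (@ps_psum _ _ _ (rho + rho)) => //; first lra.
    by rewrite (_ : rho + rho = 2 * rho)//; ring.
  have [t tr|b [ab pb]] := ps_at_ultra UF pa (v := fun t => G (t *: unit_row l + x)).
    apply: cvg_trans (cvg_app _ Foo) _; apply: Gcvg => i.
    by have := ps_bound (pg i) tr; rewrite (_ : rho + rho = 2 * rho)//; ring.
  exists (b 1%N).
    apply: (@is_derive_quad _ _ _ _ _ _ _ _ (M / rho ^+ 2) rho0) => t tr.
    have := ps_at_taylor1 pb tr; rewrite scale0r add0r.
    by rewrite /GRing.scale.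
  suff -> : (fun N => dpsum c l x0 x N) = (fun N => a N 1%N) by exact: ab.
  apply/funext => N; have [_ <-] := is_derive_psum c l x0 x N.
  by have [_ <-] := ps_at_is_derive (pa N).
exists rho, (M + rho^-1 * M); split=> //.
- move=> d g d0 pg; apply: (@ps_weaken _ _ M).
    by rewrite lerDl mulr_ge0// invr_ge0 ltW.
  by apply: CB => // i; apply: ps_weaken (pg i); lra.
- move=> l d g d0 pg; apply: (@ps_weaken _ _ (rho^-1 * M)); first by rewrite lerDr.
  have /choice[a pa] : forall N, ps d (rho^-1 * M) (fun t => dpsum c l x0 (g t) N).
    by move=> N; apply: ps_dpsum pg _.
  have [t td|b [_ pb]] := ps_at_ultra UF pa (v := pd G l \o g); last by exists b.
  have gr : `|g t - x0| <= rho.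
    by apply: rV_norm_le (ltW rho0) _ => i; rewrite !mxE; exact: ps_bound (pg i) td.
  by have [b [_ <-]] := dcvg l _ gr.
- by move=> l x /(dcvg l)[b db _]; rewrite /pd; have [_ ->] := db.
Qed.

End Multivariate.

(** * Second-order expansions and analyticity along lines *)

Section AnalyticRegularity.
Variables (R : realType) (s : nat).
Implicit Types (G : 'rV[R]_s -> R) (x y : 'rV[R]_s) (d M rho : R).

Lemma curve_bound_lip G x0 rho M x y : 0 < rho -> curve_bound G x0 rho M ->
  `|x - x0| <= rho / 2 -> `|y - x| < rho / 2 ->
  `|G y - G x| <= M / (rho / 2) * `|y - x|.
Proof.
move=> r0 CB xr yx.
have [->|yx0] := eqVneq y x; first by rewrite !subrr !normr0 mulr0.
have n0 : 0 < `|y - x| by rewrite normr_gt0 subr_eq0.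
pose w := `|y - x|^-1 *: (y - x).
have w1 : `|w| <= 1 by rewrite normrZ ger0_norm ?invr_ge0// mulVf// gt_eqF.
have r20 : 0 < rho / 2 by lra.
have P : ps (rho / 2) M (G \o (fun t => t *: w + x)).
  apply: CB => // i; have := ps_affine_coord i r20 xr w1.
  by rewrite (_ : rho / 2 + rho / 2 = rho)//; field.
have := ps_lip P (t := `|y - x|); rewrite normr_id => /(_ yx) /=.
by rewrite scale0r add0r /w scalerA divff ?gt_eqF// scale1r subrK.
Qed.

Lemma curve_bound_quad G x0 rho M x l c t : 0 < rho -> curve_bound G x0 rho M ->
  `|x - x0| <= rho / 2 -> is_derive x (unit_row R l) G c -> `|t| < rho / 2 ->
  `|G (t *: unit_row R l + x) - G x - t * c| <= M / (rho / 2) ^+ 2 * t ^+ 2.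
Proof.
move=> r0 CB xr Gc tr; have r20 : 0 < rho / 2 by lra.
have [a pa] : ps (rho / 2) M (G \o (fun t => t *: unit_row R l + x)).
  apply: CB => // i; have := ps_affine_coord i r20 xr (unit_row_norm R l).
  by rewrite (_ : rho / 2 + rho / 2 = rho)//; field.
have quad u : `|u| < rho / 2 -> `|G (u *: unit_row R l + x) - G x - u * a 1%N| <=
    M / (rho / 2) ^+ 2 * u ^+ 2.
  by move=> ur; have := ps_at_taylor1 pa ur; rewrite /= scale0r add0r.
suff -> : c = a 1%N by exact: quad.
have [_ <-] := Gc; have [_ <-//] : is_derive x (unit_row R l) G (a 1%N).
exact: is_derive_quad r20 quad.
Qed.

(** The corners of a staircase path from [x] to [y] parallel to the axes, which reduces increments
    to partial derivatives. *)
Definition mix x y k : 'rV[R]_s := \row_j (if (j < k)%N then y 0 j else x 0 j).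

Lemma mix0 x y : mix x y 0 = x.
Proof. by apply/rowP => j; rewrite mxE. Qed.

Lemma mix_full x y : mix x y s = y.
Proof. by apply/rowP => j; rewrite mxE ltn_ord. Qed.

Lemma mixS x y (k : 'I_s) : mix x y k.+1 = (y 0 k - x 0 k) *: unit_row R k + mix x y k.
Proof.
apply/rowP => j; rewrite unit_rowE !mxE ltnS leq_eqVlt.
have [->|jk] := eqVneq j k; first by rewrite eqxx/= ltnn; ring.
have -> : (nat_of_ord j == k) = false by apply/negbTE.
by rewrite /= mulr0 add0r.
Qed.

Lemma mix_near x y x0 d k : `|x - x0| < d -> `|y - x0| < d -> `|mix x y k - x0| <= d.
Proof.
move=> xd yd; apply: rV_norm_le => [|j]; first exact: le_trans (ltW xd).
rewrite !mxE; case: ifP => _.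
  by have := rV_coord_le (y - x0) j; rewrite !mxE => /le_trans; apply; exact: ltW.
by have := rV_coord_le (x - x0) j; rewrite !mxE => /le_trans; apply; exact: ltW.
Qed.

Lemma mix_dist x y k : `|mix x y k - x| <= `|y - x|.
Proof.
apply: rV_norm_le => // j; rewrite !mxE; case: ifP => _.
  by have := rV_coord_le (y - x) j; rewrite !mxE.
by rewrite subrr normr0.
Qed.

(** The increment telescopes along the staircase. Each step has a one-variable expansion, and moving
    its partial derivative from the corner back to [x] costs a second-order term, because the
    partial derivatives are Lipschitz. *)
Lemma analytic_quad G : real_analytic_scalar G -> forall x0, exists d K,
  [/\ 0 < d, 0 <= K & forall x y, `|x - x0| < d -> `|y - x0| < d ->
  [/\ `|G y - G x - \sum_(i < s) (y - x) 0 i * pd G i x| <= K * `|y - x| ^+ 2,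
      `|G y - G x| <= K * `|y - x| &
      forall l, `|pd G l y - pd G l x| <= K * `|y - x|]].
Proof.
move=> Ga x0; have [rho [M [r0 CB CBd dG]]] := analytic_curve Ga x0.
have M0 : 0 <= M.
  have : ps 1 M (G \o (fun=> x0)).
    by apply: CB => // i; apply: ps_weaken (ps_cst _ ltr01); rewrite subrr normr0 ltW.
  exact: ps_ge0.
pose K1 := M / (rho / 2); pose K2 := M / (rho / 2) ^+ 2.
have K10 : 0 <= K1 by rewrite divr_ge0//; lra.
have K20 : 0 <= K2 by rewrite divr_ge0// exprn_ge0//; lra.
have s0 : 0 <= s%:R * (K2 + K1) by rewrite mulr_ge0// addr_ge0.
(* Two points within [rho / 4] of [x0] are within [rho / 2] of each other, as the one-variable
   estimates require. *)
exists (rho / 4), (K1 + s%:R * (K2 + K1)); split; [lra| lra |].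
move=> x y xd yd.
have yx : `|y - x| < rho / 2.
  have -> : y - x = (y - x0) - (x - x0) by rewrite opprB addrA subrK.
  by apply: le_lt_trans (ler_normB _ _) _; lra.
have xr : `|x - x0| <= rho / 2 by lra.
have L1 (H : 'rV[R]_s -> R) : curve_bound H x0 rho M ->
    `|H y - H x| <= (K1 + s%:R * (K2 + K1)) * `|y - x|.
  move=> CH; apply: le_trans (curve_bound_lip r0 CH xr yx) _.
  by rewrite -/K1 ler_wpM2r// lerDl.
split; [|exact: L1|by move=> l; exact: L1].
have -> : G y - G x = \sum_(k < s) (G (mix x y k.+1) - G (mix x y k)).
  rewrite -(big_mkord xpredT (fun k => G (mix x y k.+1) - G (mix x y k))).
  by rewrite (telescope_sumr (fun k => G (mix x y k)))// mix0 mix_full.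
rewrite -sumrB; apply: le_trans (ler_norm_sum _ _ _) _.
apply: (@le_trans _ _ (\sum_(k < s) (K2 + K1) * `|y - x| ^+ 2)); last first.
  rewrite sumr_const card_ord -[leLHS]mulr_natl mulrA.
  by apply: ler_wpM2r; rewrite ?exprn_ge0//; lra.
apply: ler_sum => k _.
have yxk : `|y 0 k - x 0 k| <= `|y - x| by have := rV_coord_le (y - x) k; rewrite !mxE.
have mr : `|mix x y k - x0| <= rho / 2 by apply: le_trans (mix_near k xd yd) _; lra.
have mr' : `|mix x y k - x0| <= rho by apply: le_trans mr _; lra.
rewrite mixS.
have -> : (y - x) 0 k = y 0 k - x 0 k by rewrite !mxE.
set t := y 0 k - x 0 k.
have := curve_bound_quad r0 CB mr (dG k _ mr') (le_lt_trans yxk yx).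
rewrite -/t -/K2 => h1.
have h2 : `|pd G k (mix x y k) - pd G k x| <= K1 * `|y - x|.
  apply: le_trans (curve_bound_lip r0 (CBd k) xr (le_lt_trans (mix_dist x y k) yx)) _.
  by rewrite ler_wpM2l// mix_dist.
have -> : G (t *: unit_row R k + mix x y k) - G (mix x y k) - t * pd G k x =
  (G (t *: unit_row R k + mix x y k) - G (mix x y k) - t * pd G k (mix x y k)) +
  t * (pd G k (mix x y k) - pd G k x) by ring.
apply: le_trans (ler_normD _ _) _; rewrite [leRHS]mulrDl; apply: lerD.
  apply: le_trans h1 _; rewrite ler_wpM2l// -[t ^+ 2]real_normK ?num_real//.
  by rewrite lerXn2r ?nnegrE.
rewrite normrM mulrC expr2 mulrA; apply: ler_pM => //.
Qed.

Lemma fin_min (I : finType) (d : I -> R) : (forall i, 0 < d i) ->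
  exists2 e, 0 < e & forall i, e <= d i.
Proof.
move=> d0; exists (\big[Num.min/1]_i d i); last by move=> i; exact: bigmin_le.
by apply: lt_bigmin => [|i _]; [exact: ltr01|exact: d0].
Qed.

Lemma analytic1_comp G (g : R -> 'rV[R]_s) :
  (forall x0, exists rho M, 0 < rho /\ curve_bound G x0 rho M) ->
  (forall i, analytic1 (fun t => g t 0 i)) -> analytic1 (G \o g).
Proof.
move=> HG lg t0; have [rho [M [r0 CB]]] := HG (g t0).
have /choice[d Hd] : forall i, exists d, 0 < d /\ forall d', 0 < d' -> d' <= d ->
    ps d' rho (fun t => g (t0 + t) 0 i - g t0 0 i).
  move=> i; have [d [N pg]] := lg i t0; have d0 := ps_gt0 pg.
  have pg' := ps_add pg (ps_cst (- g t0 0 i) d0).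
  set N' := N + _ in pg'; have N'0 := ps_ge0 pg'.
  (* Below this radius the gain [d' / d] from [ps_small] brings the norm [N'] of the recentred
     coordinate under [rho]. *)
  exists (Num.min d (rho * d / (N' + 1))); split.
    rewrite lt_min d0/= divr_gt0 ?mulr_gt0//; lra.
  move=> d' d'0; rewrite le_min => /andP[dd' dr].
  apply: ps_weaken (ps_small d'0 dd' _ pg'); last by rewrite addr0 subrr.
  rewrite mulrA ler_pdivrMr//.
  have : d' * (N' + 1) <= rho * d by rewrite -ler_pdivlMr//; lra.
  by apply: le_trans; rewrite mulrC ler_wpM2l//; lra.
have [e e0 ed] := fin_min (fun i => (Hd i).1).
exists e, M; apply: (CB e (fun t => g (t0 + t))) => // i.
by apply: (Hd i).2.
Qed.

Lemma analytic1_line x w (i : 'I_s) : analytic1 (fun t => (t *: w + x) 0 i).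
Proof.
move=> t0; exists 1, (`|t0 * w 0 i + x 0 i| + `|w 0 i| * 1).
apply: ps_ext (ps_add (ps_cst (t0 * w 0 i + x 0 i) ltr01)
  (ps_mulX (ps_cst (w 0 i) ltr01))) => t _.
by rewrite !mxE; ring.
Qed.

Lemma analytic1_cst (c : R) : analytic1 (fun=> c).
Proof. by move=> t0; exists 1, `|c|; exact: ps_cst. Qed.

Lemma analytic1_common (u v : R -> R) t0 : analytic1 u -> analytic1 v -> exists d M N,
  ps d M (fun t => u (t0 + t)) /\ ps d N (fun t => v (t0 + t)).
Proof.
move=> /(_ t0) [d [M pu]] /(_ t0) [d' [N pv]].
have d0 := ps_gt0 pu; have d'0 := ps_gt0 pv.
have m0 : 0 < Num.min d d' by rewrite lt_min d0.
exists (Num.min d d'), M, N; split.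
  by apply: ps_shrink pu => //; rewrite ge_min lexx.
by apply: ps_shrink pv => //; rewrite ge_min lexx orbT.
Qed.

Lemma analytic1_add u v : analytic1 u -> analytic1 v -> @analytic1 R (fun t => u t + v t).
Proof.
move=> lu lv t0; have [d [M [N [pu pv]]]] := analytic1_common t0 lu lv.
by exists d, (M + N); exact: ps_add.
Qed.

Lemma analytic1_mul u v : analytic1 u -> analytic1 v -> @analytic1 R (fun t => u t * v t).
Proof.
move=> lu lv t0; have [d [M [N [pu pv]]]] := analytic1_common t0 lu lv.
by exists d, (M * N); exact: ps_mul.
Qed.

(** The two properties that make zero sets null: continuity makes them Borel, analyticity on lines
    isolates zeros. Both survive sums and products, hence determinants. *)
Definition line_analytic G :=
  continuous G /\ forall x w, analytic1 (fun t => G (t *: w + x)).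

Lemma line_analytic_cst c : line_analytic (fun=> c).
Proof. by split=> [|x w]; [exact: cst_continuous|exact: analytic1_cst]. Qed.

Lemma line_analyticD G H : line_analytic G -> line_analytic H ->
  line_analytic (fun x => G x + H x).
Proof.
move=> [cG lG] [cH lH]; split=> [x|x w]; last by apply: analytic1_add.
exact: (cvgD (cG x) (cH x)).
Qed.

Lemma line_analyticM G H : line_analytic G -> line_analytic H ->
  line_analytic (fun x => G x * H x).
Proof.
move=> [cG lG] [cH lH]; split=> [x|x w]; last by apply: analytic1_mul.
exact: (cvgM (cG x) (cH x)).
Qed.

Lemma line_analytic_sum (I : Type) (r : seq I) (P : pred I) (G : I -> 'rV[R]_s -> R) :
  (forall i, line_analytic (G i)) -> line_analytic (fun x => \sum_(i <- r | P i) G i x).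
Proof.
move=> lG; elim: r => [|i r ih].
  by under eq_fun do rewrite big_nil; exact: line_analytic_cst.
under eq_fun do rewrite big_cons.
by case: (P i) => //; exact: line_analyticD.
Qed.

Lemma line_analytic_prod (I : Type) (r : seq I) (P : pred I) (G : I -> 'rV[R]_s -> R) :
  (forall i, line_analytic (G i)) -> line_analytic (fun x => \prod_(i <- r | P i) G i x).
Proof.
move=> lG; elim: r => [|i r ih].
  by under eq_fun do rewrite big_nil; exact: line_analytic_cst.
under eq_fun do rewrite big_cons.
by case: (P i) => //; exact: line_analyticM.
Qed.

Lemma line_analytic_det k (A : 'rV[R]_s -> 'M[R]_k) :
  (forall i j, line_analytic (fun x => A x i j)) -> line_analytic (fun x => \det (A x)).
Proof.
move=> lA; apply: line_analytic_sum => p; apply: line_analyticM.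
  exact: line_analytic_cst.
exact: line_analytic_prod.
Qed.

Lemma line_analytic_mulmx p q r (A : 'rV[R]_s -> 'M[R]_(p, q)) (B : 'rV[R]_s -> 'M[R]_(q, r)) :
  (forall i j, line_analytic (fun x => A x i j)) ->
  (forall i j, line_analytic (fun x => B x i j)) ->
  forall i j, line_analytic (fun x => (A x *m B x) i j).
Proof.
move=> lA lB i j; under eq_fun do rewrite mxE.
by apply: line_analytic_sum => k; exact: line_analyticM.
Qed.

Lemma lip_continuous_at (W : normedModType R) (f : 'rV[R]_s -> W) x0 d (K : R) :
  0 < d -> (forall y, `|y - x0| < d -> `|f y - f x0| <= K * `|y - x0|) ->
  {for x0, continuous f}.
Proof.
move=> d0 L.
apply/(@cvgrPdist_le _ _ _ (nbhs x0) (nbhs_filter x0) f (f x0)) => e e0.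
have K0 := normr_ge0 K.
apply/nbhs_ballP; exists (Num.min d (e / (`|K| + 1))).
  rewrite /= lt_min d0/= divr_gt0//; lra.
move=> y /rV_ballE; rewrite lt_min => /andP[yd ye].
rewrite distrC; apply: le_trans (L y yd) _.
have : `|y - x0| * (`|K| + 1) <= e by rewrite -ler_pdivlMr ?ltW//; lra.
apply: le_trans; rewrite mulrC ler_wpM2l//; have := ler_norm K; lra.
Qed.

Lemma analytic_continuous G : real_analytic_scalar G -> continuous G.
Proof.
move=> Ga x0; have [d [K [d0 K0 L]]] := analytic_quad Ga x0.
apply: (lip_continuous_at d0 (K := K)) => y yd.
by have [] := L x0 y; rewrite ?subrr ?normr0.
Qed.

Lemma pd_continuous G l : real_analytic_scalar G -> continuous (pd G l).
Proof.
move=> Ga x0; have [d [K [d0 K0 L]]] := analytic_quad Ga x0.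
apply: (lip_continuous_at d0 (K := K)) => y yd.
by have [] := L x0 y; rewrite ?subrr ?normr0.
Qed.

Lemma analytic_comp_analytic1 G (g : R -> 'rV[R]_s) : real_analytic_scalar G ->
  (forall i, analytic1 (fun t => g t 0 i)) -> analytic1 (fun t => G (g t)).
Proof.
move=> Ga; apply: analytic1_comp => x0; have [rho [M [? ? _ _]]] := analytic_curve Ga x0.
by exists rho, M.
Qed.

Lemma pd_comp_analytic1 G l (g : R -> 'rV[R]_s) : real_analytic_scalar G ->
  (forall i, analytic1 (fun t => g t 0 i)) -> analytic1 (fun t => pd G l (g t)).
Proof.
move=> Ga; apply: analytic1_comp => x0; have [rho [M [? _ ? _]]] := analytic_curve Ga x0.
by exists rho, M.
Qed.

Lemma analytic_line_analytic G : real_analytic_scalar G -> line_analytic G.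
Proof.
move=> Ga; split; first exact: analytic_continuous.
by move=> x w; apply: analytic_comp_analytic1 Ga _ => i; exact: analytic1_line.
Qed.

Lemma pd_line_analytic G l : real_analytic_scalar G -> line_analytic (pd G l).
Proof.
move=> Ga; split; first exact: pd_continuous.
by move=> x w; apply: pd_comp_analytic1 Ga _ => i; exact: analytic1_line.
Qed.

End AnalyticRegularity.

Section RowContinuity.
Variables (R : realType) (s m : nat) (h : 'rV[R]_s -> 'rV[R]_m).

Lemma row_continuous : (forall i, continuous (fun x => h x 0 i)) -> continuous h.
Proof.
move=> ch x; apply/(@cvgrPdist_lt _ _ _ (nbhs x) (nbhs_filter x)) => e e0.
have /filter_forall : forall i, \forall y \near x, `|h x 0 i - h y 0 i| < e.
  move=> i.
  by move: (ch i x) => /(@cvgrPdist_lt _ _ _ (nbhs x) (nbhs_filter x)) /(_ e e0).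
apply: filterS => y hy.
apply: (@le_lt_trans _ _ (\big[Num.max/0]_i `|h x 0 i - h y 0 i|)).
  apply: rV_norm_le => [|i]; first exact: bigmax_ge_id.
  by rewrite !mxE; exact: le_bigmax.
by apply/bigmax_lt.
Qed.

End RowContinuity.

(** * Lebesgue outer measure *)

Section OuterMeasure.
(* The dimension is positive: for [s = 0] every box has volume [1], so the
   infimum defining [lebesgue_outer set0] is infinite. *)
Variables (R : realType) (s' : nat).
Let s := s'.+1.
Implicit Types (A X S : set 'rV[R]_s) (a b x v : 'rV[R]_s).

Lemma box_vol_ge0 a b : 0 <= box_vol a b.
Proof. by apply: prodr_ge0 => i _; rewrite le_max lexx. Qed.

Lemma box_vol_refl a : box_vol a a = 0.
Proof. by rewrite /box_vol big_ord_recl subrr maxxx mul0r. Qed.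

Lemma lebesgue_outer_ge0 A : (0 <= lebesgue_outer A)%E.
Proof.
apply: le_ereal_inf_tmp => _ [ab _ <-].
by apply: nneseries_ge0 => n _ _; rewrite lee_fin box_vol_ge0.
Qed.

Lemma lebesgue_outer_le A (ab : nat -> 'rV[R]_s * 'rV[R]_s) :
  A `<=` \bigcup_k box (ab k).1 (ab k).2 ->
  (lebesgue_outer A <= \sum_(0 <= k <oo) (box_vol (ab k).1 (ab k).2)%:E)%E.
Proof. by move=> Aab; apply: ereal_inf_lbound; exists ab. Qed.

Lemma lebesgue_outer_box a b : (lebesgue_outer (box a b) <= (box_vol a b)%:E)%E.
Proof.
apply: le_trans (lebesgue_outer_le (ab := fun k => if k is 0 then (a, b) else (0, 0)) _) _.
  by move=> x xab; exists 0%N.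
rewrite nneseries_recl//=; last by move=> k _; rewrite lee_fin box_vol_ge0.
rewrite eseries0 ?adde0// => -[|k]//= _ _.
by rewrite box_vol_refl.
Qed.

Lemma lebesgue_outer0 : lebesgue_outer (set0 : set 'rV[R]_s) = 0%E.
Proof.
apply/eqP; rewrite eq_le lebesgue_outer_ge0 andbT.
apply: le_trans (lebesgue_outer_le (ab := fun=> (0, 0)) _) _ => //.
by rewrite eseries0// => k _ _; rewrite box_vol_refl.
Qed.

Lemma le_lebesgue_outer A X : A `<=` X -> (lebesgue_outer A <= lebesgue_outer X)%E.
Proof.
move=> AX; apply: le_ereal_inf_tmp => _ [ab /= Xab <-].
by apply: lebesgue_outer_le; exact: subset_trans Xab.
Qed.

Lemma lebesgue_outer_adherent A (e : R) : 0 < e -> lebesgue_outer A != +oo%E ->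
  exists2 ab : nat -> 'rV[R]_s * 'rV[R]_s, A `<=` \bigcup_k box (ab k).1 (ab k).2 &
  (\sum_(0 <= k <oo) (box_vol (ab k).1 (ab k).2)%:E <= lebesgue_outer A + e%:E)%E.
Proof.
move=> e0 Aoo; have Afin : lebesgue_outer A \is a fin_num.
  by rewrite ge0_fin_numE ?lebesgue_outer_ge0// ltey.
have [_ [ab Aab <-] /ltW abA] := lb_ereal_inf_adherent e0 Afin.
by exists ab.
Qed.

Lemma lebesgue_outer_sigma_subadditive :
  sigma_subadditive (@lebesgue_outer R s).
Proof.
move=> A; have [[i ioo]|] := pselect (exists i, lebesgue_outer (A i) = +oo%E).
  rewrite (eseries_pinfty _ _ ioo) ?leey// => n _.
  by rewrite gt_eqF// (lt_le_trans _ (lebesgue_outer_ge0 _)).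
move=> /forallNP Afin; apply/lee_addgt0Pr => e e0.
apply: le_trans (epsilon_trick _ (fun n => lebesgue_outer_ge0 (A n)) (ltW e0)).
have en n : 0 < e / (2 ^ n.+1)%:R by rewrite divr_gt0// ltr0n expn_gt0.
have /choice[G GP] : forall n, exists ab : nat -> 'rV[R]_s * 'rV[R]_s,
    A n `<=` \bigcup_k box (ab k).1 (ab k).2 /\
    (\sum_(0 <= k <oo) (box_vol (ab k).1 (ab k).2)%:E <=
      lebesgue_outer (A n) + (e / (2 ^ n.+1)%:R)%:E)%E.
  move=> n; have /eqP An := Afin n.
  by have [ab ? ?] := lebesgue_outer_adherent (en n) An; exists ab.
pose V (p : nat * nat) := (box_vol (G p.1 p.2).1 (G p.1 p.2).2)%:E.
have V0 p : (0 <= V p)%E by rewrite lee_fin box_vol_ge0.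
have /card_esym/card_set_bijP[f fbij] := card_nat2.
apply: (@le_trans _ _ (\esum_(p in [set: nat * nat]) V p)).
  rewrite (@reindex_esum _ _ _ _ _ _ V fbij) -nneseries_esumT; last by move=> k; exact: V0.
  apply: (lebesgue_outer_le (ab := fun k => G (f k).1 (f k).2)) => x [n _ /(GP n).1 [k _ xk]].
  have [_ _ /(_ (n, k) I) [j _ fj]] := fbij.
  by exists j => //; rewrite fj.
have -> : \esum_(p in [set: nat * nat]) V p =
    \esum_(i in [set: nat]) \esum_(j in [set: nat]) V (i, j).
  rewrite (@esum_esum _ _ _ setT (fun=> setT) (fun i j => V (i, j)))//.
  rewrite (_ : _ `*`` _ = setT); last by apply/seteqP; split.
  by apply: eq_esum => -[].
rewrite -nneseries_esumT; last by move=> n; apply: esum_ge0 => k _; exact: V0.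
apply: lee_nneseries => n _; first by move=> _; apply: esum_ge0 => k _; exact: V0.
rewrite -nneseries_esumT; last by move=> k; exact: V0.
exact: (GP n).2.
Qed.

HB.instance Definition _ := isOuterMeasure.Build R 'rV[R]_s (@lebesgue_outer R s)
  lebesgue_outer0 lebesgue_outer_ge0 le_lebesgue_outer
  lebesgue_outer_sigma_subadditive.

Definition set_coord a i c : 'rV[R]_s := \row_j (if j == i then c else a 0 j).

Lemma max_split (x y c : R) : Num.max 0 (Num.min y c - x) +
  Num.max 0 (y - Num.max x c) = Num.max 0 (y - x).
Proof.
have [xc|cx] := leP x c; have [yc|cy] := leP y c.
- by rewrite [X in _ + X]max_l ?addr0//; lra.
- by rewrite !max_r; lra.
- by rewrite !max_l; lra.
- by rewrite [X in X + _]max_l ?add0r//; lra.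
Qed.

(** Cutting a box by the hyperplane x_i = c. The [min] and [max] also cover a hyperplane that misses
    the box: one piece then has volume zero. *)
Lemma box_vol_split a b i c :
  box_vol a (set_coord b i (Num.min (b 0 i) c)) +
  box_vol (set_coord a i (Num.max (a 0 i) c)) b = box_vol a b.
Proof.
rewrite /box_vol (bigD1 i)//= [X in _ + X](bigD1 i)//= [RHS](bigD1 i)//=.
rewrite (eq_bigr (fun j => Num.max 0 (b 0 j - a 0 j))) => [|j /negbTE ji]; last first.
  by rewrite !mxE ji.
rewrite [X in _ + _ * X](eq_bigr (fun j => Num.max 0 (b 0 j - a 0 j))) => [|j /negbTE ji]; last first.
  by rewrite !mxE ji.
rewrite -mulrDl !mxE eqxx; congr (_ * _).
exact: max_split.
Qed.

(** Every box of a cover is cut along the hyperplane. The inclusions leave the hyperplane itself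
    unassigned, so open and closed half-spaces are treated together. *)
Lemma halfspace_caratheodory (H : set 'rV[R]_s) i (c : R) :
  H `<=` [set x | x 0 i <= c] -> ~` H `<=` [set x | c <= x 0 i] ->
  (@lebesgue_outer R s).-caratheodory H.
Proof.
move=> Hc HCc; apply: le_caratheodory_measurable => X.
apply: le_ereal_inf_tmp => _ [ab /= Xab <-].
under eq_eseriesr do rewrite -(box_vol_split _ _ i c) EFinD.
rewrite nneseriesD => [|k _ _|k _ _]; try by rewrite lee_fin box_vol_ge0.
apply: leeD.
  apply: (lebesgue_outer_le (ab := fun k => ((ab k).1,
    set_coord (ab k).2 i (Num.min ((ab k).2 0 i) c)))) => x [/Xab[k _ xk] /Hc xc].
  exists k => // j; have := xk j; rewrite !mxE/=; case: eqP => [->|_]//.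
  by rewrite le_min => /andP[-> ->].
apply: (lebesgue_outer_le (ab := fun k =>
  (set_coord (ab k).1 i (Num.max ((ab k).1 0 i) c), (ab k).2))) => x [/Xab[k _ xk] /HCc xc].
exists k => // j; have := xk j; rewrite !mxE/=; case: eqP => [->|_]//.
by rewrite ge_max => /andP[-> ->]; rewrite andbT.
Qed.

Lemma rat_ball_basis x (e : R) : 0 < e -> exists q : 'rV[rat]_s, exists n : nat,
  ball (map_mx ratr q : 'rV[R]_s) n.+1%:R^-1 x /\
  ball (map_mx ratr q : 'rV[R]_s) n.+1%:R^-1 `<=` ball x e.
Proof.
move=> e0; pose n := Num.truncn (2 / e).
have ne : n.+1%:R^-1 < e / 2.
  rewrite -[e / 2]invrK invf_div ltf_pV2 ?posrE ?divr_gt0//.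
  exact: truncnS_gt.
have n0 : 0 < n.+1%:R^-1 :> R by rewrite invr_gt0.
suff [q qx] : exists q : 'rV[rat]_s, ball (map_mx ratr q : 'rV[R]_s) n.+1%:R^-1 x.
  exists q, n; split=> // y qy; apply: (@le_ball _ _ _ (n.+1%:R^-1 + n.+1%:R^-1)).
    by rewrite [leRHS](splitr e) lerD// ltW.
  exact: ball_triangle (ball_sym qx) qy.
move: n0; set r := n.+1%:R^-1 => r0.
have /choice[q qx] : forall i, exists q : rat, `|x 0 i - ratr q| < r.
  move=> i; have lt_ : x 0 i - r < x 0 i + r by lra.
  have [q] := rat_in_itvoo lt_; rewrite in_itv/= => /andP[q1 q2]; exists q.
  by rewrite ltr_distlC; apply/andP; split; lra.
exists (\row_i q i).
by split=> // i j; rewrite !mxE !ord1 /ball/= distrC qx.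
Qed.

(** A countable base of the topology, enumerated by [pickle]; an index that encodes no pair gives
    the empty set. *)
Definition rat_ball (k : nat) : set 'rV[R]_s :=
  if unpickle k is Some p then
    ball (map_mx ratr (p : 'rV[rat]_s * nat).1 : 'rV[R]_s) p.2.+1%:R^-1
  else set0.

Lemma rat_ballP x (e : R) : 0 < e -> exists k, rat_ball k x /\ rat_ball k `<=` ball x e.
Proof.
move=> /rat_ball_basis -/(_ x)[q [n qn]]; exists (pickle (q, n)).
by rewrite /rat_ball pickleK.
Qed.

(** In the supremum norm a ball is a finite intersection of open half-spaces. *)
Lemma caratheodory_ball x (e : R) : (@lebesgue_outer R s).-caratheodory (ball x e).
Proof.
have [e0|e0] := ltP 0 e; last first.
  rewrite (_ : ball x e = set0); first exact: caratheodory_measurable_set0.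
  by rewrite -subset0 => y [/(le_lt_trans e0)]; rewrite ltxx.
have -> : ball x e = \big[setI/setT]_(i < s)
    ([set y | y 0 i < x 0 i + e] `&` [set y | x 0 i - e < y 0 i]).
  rewrite -bigcap_seq; apply/seteqP; split=> y.
    move=> [_ xy] i _ /=; have := xy 0 i; rewrite /ball/= ltr_distlC.
    by move=> /andP[? ?]; split; lra.
  move=> H; split=> // i j; rewrite ord1 /ball/= ltr_distlC.
  by have /= [? ?] := H j (mem_index_enum j); apply/andP; split; lra.
elim/big_ind : _ => [|A B|i _].
- rewrite -setC0; apply: caratheodory_measurable_setC.
  exact: caratheodory_measurable_set0.
- exact: caratheodory_measurable_setI.
- apply: caratheodory_measurable_setI.
    apply: (@halfspace_caratheodory _ i (x 0 i + e)) => y /=; first exact: ltW.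
    by move/negP; rewrite -leNgt.
  rewrite -[X in _ X]setCK; apply: caratheodory_measurable_setC.
  apply: (@halfspace_caratheodory _ i (x 0 i - e)) => y /=.
    by move/negP; rewrite -leNgt.
  by rewrite notK; exact: ltW.
Qed.

Lemma borel_caratheodory A : borel_set A -> (@lebesgue_outer R s).-caratheodory A.
Proof.
apply: smallest_sub A.
  split; first exact: caratheodory_measurable_set0.
    by move=> A mA; rewrite setTD; exact: caratheodory_measurable_setC.
  by move=> F mF; exact: caratheodory_measurable_bigcup.
move=> U /= oU.
have -> : U = \bigcup_k (if pselect (rat_ball k `<=` U) then rat_ball k else set0).
  apply/seteqP; split=> x.
    move=> Ux; have /nbhs_ballP[e /= e0 xeU] : nbhs x U by exact: open_nbhs_nbhs.
    have [k [kx kxe]] := rat_ballP x e0; exists k => //.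
    by case: pselect => // -[]; exact: subset_trans xeU.
  by move=> [k _]; case: pselect => // kU; exact: kU.
apply: caratheodory_measurable_bigcup => k; case: pselect => _ /=.
  rewrite /rat_ball; case: unpickle => [p|]; first exact: caratheodory_ball.
  exact: caratheodory_measurable_set0.
exact: caratheodory_measurable_set0.
Qed.

Lemma outer_null_bigcup (A : nat -> set 'rV[R]_s) :
  (forall k, lebesgue_outer (A k) = 0%E) -> lebesgue_outer (\bigcup_k A k) = 0%E.
Proof.
move=> A0; apply/eqP; rewrite eq_le lebesgue_outer_ge0 andbT.
apply: le_trans (lebesgue_outer_sigma_subadditive A) _.
by rewrite eseries0.
Qed.

Lemma outer_null_subset A X : A `<=` X -> lebesgue_outer X = 0%E -> lebesgue_outer A = 0%E.
Proof.
move=> /le_lebesgue_outer AX X0.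
by apply/eqP; rewrite eq_le lebesgue_outer_ge0 andbT -X0.
Qed.

Lemma outer_null_setU A X : lebesgue_outer A = 0%E -> lebesgue_outer X = 0%E ->
  lebesgue_outer (A `|` X) = 0%E.
Proof.
move=> A0 X0; apply: (@outer_null_subset _ (\bigcup_k (if k is 0 then A else X))).
  by move=> x [Ax|Xx]; [exists 0%N|exists 1%N].
by apply: outer_null_bigcup => -[|k].
Qed.

(** Lindelöf's argument: each point of [O] lies in a basic ball inside its given ball, and only
    countably many basic balls exist. *)
Lemma outer_null_local A (O : set 'rV[R]_s) : (forall x, O x -> exists2 e : R, 0 < e &
    lebesgue_outer (A `&` ball x e) = 0%E) -> lebesgue_outer (A `&` O) = 0%E.
Proof.
move=> AO; pose B k := if pselect (lebesgue_outer (A `&` rat_ball k) = 0%E)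
  then A `&` rat_ball k else set0.
apply: (@outer_null_subset _ (\bigcup_k B k)).
  move=> x [Ax /AO[e e0 xe]]; have [k [kx kxe]] := rat_ballP x e0.
  exists k => //; rewrite /B; case: pselect => //= -[].
  by apply: outer_null_subset xe; exact: setIS.
by apply: outer_null_bigcup => k; rewrite /B; case: pselect => //= _.
Qed.

(** Pulling a cover back divides its side lengths by [l]. The case [l > 1] serves the dilates,
    [l = 1] the translates; a packing asks only that copies be no smaller. *)
Lemma lebesgue_outer_affine S (l : R) v : 1 <= l ->
  (lebesgue_outer S <= lebesgue_outer [set (l *: x + v)%R | x in S])%E.
Proof.
move=> l1; have l0 : 0 < l by lra.
apply: le_ereal_inf_tmp => _ [ab /= Sab <-].
apply: le_trans (lebesgue_outer_le
  (ab := fun k => (l^-1 *: ((ab k).1 - v), l^-1 *: ((ab k).2 - v))) _) _.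
  move=> x Sx; have [|k _ xk] := Sab (l *: x + v); first by exists x.
  exists k => // i; have := xk i; rewrite !mxE => /andP[h1 h2].
  by apply/andP; split; rewrite -(ler_pM2l l0) mulVKf ?gt_eqF//; lra.
apply: lee_nneseries => k _; first by move=> _; rewrite lee_fin box_vol_ge0.
rewrite lee_fin; apply: ler_prod => i _; rewrite le_max lexx/= !mxE.
rewrite ge_max le_max lexx/= -mulrBr.
have -> : (ab k).2 0 i - v 0 i - ((ab k).1 0 i - v 0 i) = (ab k).2 0 i - (ab k).1 0 i by ring.
have [h|h] := leP 0 ((ab k).2 0 i - (ab k).1 0 i).
  by rewrite -[leRHS]mul1r ler_wpM2r// invf_le1.
by rewrite pmulr_rle0 ?invr_gt0// ltW.
Qed.

Lemma lebesgue_outer_bounded S (B : R) : S `<=` [set x | `|x| <= B] ->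
  (lebesgue_outer S < +oo)%E.
Proof.
move=> SB.
apply: (@le_lt_trans _ _ (box_vol (const_mx (- B)) (const_mx B : 'rV[R]_s))%:E); last exact: ltry.
apply: le_trans (lebesgue_outer_box _ _); apply: le_lebesgue_outer => x /SB/= xB i.
by rewrite !mxE -ler_norml; apply: le_trans (rV_coord_le _ _) xB.
Qed.

(** Additivity puts [n] times the measure of [S] below that of one bounded set, for every [n]. *)
Lemma packing_null S (T : nat -> set 'rV[R]_s) (B : R) :
  (forall i, (@lebesgue_outer R s).-caratheodory (T i)) -> trivIset setT T ->
  (forall i, lebesgue_outer S <= lebesgue_outer (T i))%E ->
  (forall i, T i `<=` [set x | `|x| <= B]) -> lebesgue_outer S = 0%E.
Proof.
move=> mT tT ST TB; set W := [set x : 'rV[R]_s | `|x| <= B].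
have Woo : (lebesgue_outer W < +oo)%E by exact: (@lebesgue_outer_bounded _ B).
have SW n : (n%:R%:E * lebesgue_outer S <= lebesgue_outer W)%E.
  apply: (@le_trans _ _ (lebesgue_outer (W `&` \big[setU/set0]_(i < n) T i))); last first.
    by apply: le_lebesgue_outer; exact: subIsetl.
  rewrite (caratheodory_additive mT tT n W).
  apply: (@le_trans _ _ (\sum_(i < n) lebesgue_outer S)%E).
    by rewrite sumr_const card_ord mule_natl.
  apply: lee_sum => i _; apply: le_trans (ST i) _; apply: le_lebesgue_outer => x Tx.
  by split=> //; exact: TB Tx.
apply/eqP; rewrite eq_le lebesgue_outer_ge0 andbT leNgt; apply/negP => S0.
have Sfin : lebesgue_outer S \is a fin_num.
  rewrite ge0_fin_numE ?lebesgue_outer_ge0//; apply: le_lt_trans Woo.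
  by have := SW 1%N; rewrite mul1e.
have Wfin : lebesgue_outer W \is a fin_num.
  by rewrite ge0_fin_numE ?lebesgue_outer_ge0.
move: S0 SW; rewrite -(fineK Sfin) -(fineK Wfin) lte_fin => S0 SW.
have := SW (Num.truncn (fine (lebesgue_outer W) / fine (lebesgue_outer S))).+1.
rewrite -EFinM lee_fin leNgt -ltr_pdivrMr//.
by rewrite truncnS_gt.
Qed.

End OuterMeasure.

(** * Lipschitz images of null sets and zero sets of analytic functions *)

Section NullSets.
Variables (R : realType) (s' : nat).
Let s := s'.+1.
Implicit Types (D S : set 'rV[R]_s) (T : 'rV[R]_s -> 'rV[R]_s) (a b x v : 'rV[R]_s).

Lemma lebesgue_outer_fin (I : finType) (A : I -> set 'rV[R]_s) (c : R) :
  (forall i, lebesgue_outer (A i) <= c%:E)%E ->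
  (lebesgue_outer [set x | exists i, A i x] <= (#|I|%:R * c)%:E)%E.
Proof.
move=> Ac; have -> : [set x | exists i, A i x] = \big[setU/set0]_(i <- enum I) A i.
  rewrite -bigcup_seq; apply/seteqP; split=> x; first by move=> [i Aix]; exists i => //=; rewrite mem_enum.
  by move=> [i _ Aix]; exists i.
rewrite cardE; elim: (enum I) => [|i r ih].
  by rewrite big_nil mul0r lebesgue_outer0.
rewrite big_cons /= -natr1 mulrDl mul1r addrC EFinD.
by apply: le_trans (outer_measureU2 _ _ _) _; apply: leeD; [exact: Ac|exact: ih].
Qed.

Lemma borel_sigma_algebra : sigma_algebra setT (@borel_set R s).
Proof. exact: smallest_sigma_algebra. Qed.

Lemma borel_open S : open S -> borel_set S.
Proof. by move=> oS; apply: sub_gen_smallest. Qed.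

Lemma borel_setC S : borel_set S -> borel_set (~` S).
Proof. by have [_ h _] := borel_sigma_algebra; move=> /h; rewrite setTD. Qed.

Lemma borel_bigcup (S : nat -> set 'rV[R]_s) :
  (forall k, borel_set (S k)) -> borel_set (\bigcup_k S k).
Proof. by have [_ _] := borel_sigma_algebra; exact. Qed.

Lemma borel_bigcap (S : nat -> set 'rV[R]_s) :
  (forall k, borel_set (S k)) -> borel_set (\bigcap_k S k).
Proof.
move=> bS; rewrite -[\bigcap_k _]setCK setC_bigcap; apply: borel_setC.
by apply: borel_bigcup => k; exact: borel_setC.
Qed.

Lemma borel_setI S S2 : borel_set S -> borel_set S2 -> borel_set (S `&` S2).
Proof.
move=> b1 b2; have -> : S `&` S2 = \bigcap_k (if k is 0 then S else S2).
  apply/seteqP; split=> x; first by move=> [h1 h2] [].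
  by move=> h; split; [exact: h 0%N I|exact: h 1%N I].
by apply: borel_bigcap => -[].
Qed.

Lemma borel_preimage_open (f : 'rV[R]_s -> 'rV[R]_s) (V : set 'rV[R]_s) S :
  open V -> (forall x, V x -> {for x, continuous f}) ->
  borel_set S -> borel_set (V `&` f @^-1` S).
Proof.
move=> oV cf; pose E := [set S | borel_set (V `&` f @^-1` S)].
apply: (@smallest_sub _ _ _ E).
  split; first by rewrite /E/= preimage_set0 setI0; have [] := borel_sigma_algebra.
    move=> A EA; rewrite /E/= setTD.
    have -> : V `&` f @^-1` (~` A) = V `&` ~` (V `&` f @^-1` A).
      apply/seteqP; split=> x [Vx h]; split=> //; first by move=> [_ /h].
      by move=> Ax; apply: h.
    by apply: borel_setI; [exact: borel_open|exact: borel_setC].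
  move=> A EA; rewrite /E/= preimage_bigcup setI_bigcupr.
  exact: borel_bigcup.
move=> U /= oU; apply: borel_open; rewrite openE => x [Vx Ufx].
apply: filterI; first exact: open_nbhs_nbhs.
by apply: (cf x Vx); exact: open_nbhs_nbhs.
Qed.

Definition grid a (d : R) (k : 'I_s -> nat) : set 'rV[R]_s :=
  [set x | forall i, a 0 i + (k i)%:R * d <= x 0 i <= a 0 i + (k i).+1%:R * d].

(** [T] is controlled only on [D], so the enclosing box is centred at the image of some point of [D]
    in the cell, with half-side [L * d]; hence the factor 2. *)
Lemma lip_cell_outer D T (L d : R) a k : 0 <= L -> 0 < d ->
  (forall x y, D x -> D y -> `|T x - T y| <= L * `|x - y|) ->
  (lebesgue_outer (T @` (D `&` grid a d k)) <= ((2 * L * d) ^+ s)%:E)%E.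
Proof.
move=> L0 d0 TL; have Ld0 : 0 <= 2 * L * d by rewrite !mulr_ge0// ltW.
have [[x0 [Dx0 gx0]]|/forallNP nex] := pselect (exists x, (D `&` grid a d k) x); last first.
  rewrite (_ : _ @` _ = set0) ?lebesgue_outer0 ?lee_fin ?exprn_ge0//.
  by rewrite -subset0 => y [x Dx _]; exact: nex Dx.
apply: (@le_trans _ _ (box_vol (T x0 - const_mx (L * d)) (T x0 + const_mx (L * d)))%:E).
  apply: le_trans (lebesgue_outer_box _ _); apply: le_lebesgue_outer.
  move=> _ [x [Dx gx] <-] i; rewrite !mxE -ler_distlC.
  have := rV_coord_le (T x0 - T x) i; rewrite !mxE => /le_trans; apply.
  apply: le_trans (TL _ _ Dx0 Dx) _; rewrite ler_wpM2l//.
  apply: rV_norm_le => [|j]; first exact: ltW.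
  rewrite !mxE ler_distlC.
  have /andP[h1 h2] := gx j; have /andP[h3 h4] := gx0 j.
  have e1 : (k j).+1%:R * d = (k j)%:R * d + d by rewrite -natr1 mulrDl mul1r.
  by rewrite e1 in h2 h4; apply/andP; split; lra.
rewrite lee_fin /box_vol (eq_bigr (fun=> 2 * L * d)) => [|i _].
  by rewrite prodr_const card_ord.
have := mulr_ge0 L0 (ltW d0); rewrite !mxE => Ld.
by rewrite max_r; [ring|lra].
Qed.

Lemma lip_box_outer_grid D T (L d : R) a b : 0 <= L -> 0 < d ->
  (forall i, a 0 i <= b 0 i) ->
  (forall x y, D x -> D y -> `|T x - T y| <= L * `|x - y|) ->
  (lebesgue_outer (T @` (D `&` box a b)) <=
   ((2 * L) ^+ s * \prod_(i < s) (b 0 i - a 0 i + d))%:E)%E.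
Proof.
(* The successor makes room for points on the far face and accounts for the extra [d] in each side
   of the bound. *)
move=> L0 d0 ab TL; pose N i := (Num.truncn ((b 0 i - a 0 i) / d)).+1.
pose K := {dffun forall i : 'I_s, 'I_(N i)}.
pose A (k : K) := T @` (D `&` grid a d (fun i => nat_of_ord (k i))).
have cover : T @` (D `&` box a b) `<=` [set x | exists k, A k x].
  move=> _ [x [Dx xab] <-].
  have q0 i : 0 <= (x 0 i - a 0 i) / d.
    by rewrite divr_ge0 ?(ltW d0)// subr_ge0; have /andP[] := xab i.
  pose q i := (x 0 i - a 0 i) / d.
  have kN i : (Num.truncn (q i) < N i)%N.
    rewrite ltnS; apply: le_truncn; rewrite ler_pM2r ?invr_gt0//.
    by have /andP[_] := xab i; lra.
  pose k : K := [ffun i => Ordinal (kN i)].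
  exists k, x => //; split=> // i; rewrite /= ffunE/=.
  have /andP[h1 h2] := truncn_itv (q0 i).
  move: h1 h2; rewrite ler_pdivlMr// ltr_pdivrMr// => h1 h2.
  by apply/andP; split; lra.
apply: le_trans (le_lebesgue_outer cover) _.
apply: le_trans (lebesgue_outer_fin (fun k => lip_cell_outer a _ L0 d0 TL)) _.
rewrite lee_fin exprMn mulrCA ler_wpM2l ?exprn_ge0 ?mulr_ge0//.
have -> : d ^+ s = \prod_(i < s) d by rewrite prodr_const card_ord.
rewrite card_dep_ffun foldrE big_map big_enum /= natr_prod -big_split/=.
apply: ler_prod => i _; rewrite card_ord mulr_ge0 ?(ltW d0)//= /N -natr1 mulrDl mul1r.
rewrite lerD2r -ler_pdivlMr// truncn_le divr_ge0 ?(ltW d0)//.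
by rewrite subr_ge0.
Qed.

(** The grid estimate in the limit of mesh size [d] tending to 0; an empty box is treated apart,
    since its sides may be negative. *)
Lemma lip_box_outer D T (L : R) a b : 0 <= L ->
  (forall x y, D x -> D y -> `|T x - T y| <= L * `|x - y|) ->
  (lebesgue_outer (T @` (D `&` box a b)) <= ((2 * L) ^+ s * box_vol a b)%:E)%E.
Proof.
move=> L0 TL; have C0 : 0 <= (2 * L) ^+ s by rewrite exprn_ge0// mulr_ge0.
have [ab|/existsNP[i /negP]] := pselect (forall i, a 0 i <= b 0 i); last first.
  rewrite -ltNge => ba.
  rewrite (_ : _ @` _ = set0) ?lebesgue_outer0 ?lee_fin ?mulr_ge0 ?box_vol_ge0//.
  rewrite -subset0 => y [x [_ /(_ i) /andP[h1 h2]] _].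
  by have := lt_le_trans ba (le_trans h1 h2); rewrite ltxx.
have bound d : 0 < d -> _ := fun d0 => lip_box_outer_grid L0 d0 ab TL.
set m := lebesgue_outer _ in bound *.
have mfin : m \is a fin_num.
  rewrite ge0_fin_numE ?lebesgue_outer_ge0//.
  by apply: le_lt_trans (bound 1 ltr01) _; exact: ltry.
rewrite -(fineK mfin) lee_fin.
have -> : box_vol a b = \prod_(i < s) (b 0 i - a 0 i + 0).
  by apply: eq_bigr => i _; rewrite addr0 max_r// subr_ge0.
apply: (@cvgr_to_ge _ (0 : R)^'+ _ _
    (fun d => (2 * L) ^+ s * \prod_(i < s) (b 0 i - a 0 i + d))).
  apply: cvg_at_right_filter; apply: cvgM; first exact: cvg_cst.
  apply: cvg_big => [|i _]; first exact: mul_continuous.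
  by apply: cvgD; [exact: cvg_cst|exact: cvg_id].
near=> d; rewrite -lee_fin fineK//; apply: bound; near: d.
exact: nbhs_right_gt.
Unshelve. all: by end_near. Qed.

Lemma lip_null D T (L : R) : 0 <= L ->
  (forall x y, D x -> D y -> `|T x - T y| <= L * `|x - y|) ->
  lebesgue_outer D = 0%E -> lebesgue_outer (T @` D) = 0%E.
Proof.
move=> L0 TL D0; apply/eqP; rewrite eq_le lebesgue_outer_ge0 andbT.
have C0 : 0 <= (2 * L) ^+ s by rewrite exprn_ge0// mulr_ge0.
set C := (2 * L) ^+ s in C0.
apply/lee_addgt0Pr => e e0; rewrite add0e.
have e0' : 0 < e / (C + 1) by rewrite divr_gt0//; lra.
have [|ab Dab abe] := lebesgue_outer_adherent (A := D) e0'; first by rewrite D0.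
have cover : T @` D `<=` \bigcup_k (T @` (D `&` box (ab k).1 (ab k).2)).
  by move=> _ [x Dx <-]; have [k _ xk] := Dab x Dx; exists k => //; exists x.
apply: le_trans (le_lebesgue_outer cover) _.
apply: le_trans (lebesgue_outer_sigma_subadditive _) _.
apply: (@le_trans _ _ (\sum_(0 <= k <oo) (C%:E * (box_vol (ab k).1 (ab k).2)%:E))%E).
  apply: lee_nneseries => k _; first by move=> _; exact: lebesgue_outer_ge0.
  by rewrite -EFinM; exact: lip_box_outer.
rewrite nneseriesZl; last by move=> k _; rewrite lee_fin box_vol_ge0.
rewrite D0 add0e in abe.
apply: le_trans (lee_wpmul2l _ abe) _; first by rewrite lee_fin.
rewrite -EFinM lee_fin mulrCA ger_pMr// ler_pdivrMr ?mul1r; lra.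
Qed.

(* Every zero of [F] is isolated on the line through it and [q], so along a
   sequence of ratios tending to [1] the dilates about [q] of a suitable piece
   of the zero set are pairwise disjoint. *)
Lemma zero_set_null (F : 'rV[R]_s -> R) q : line_analytic F -> F q != 0 ->
  lebesgue_outer [set x | F x = 0] = 0%E.
Proof.
(* Ratios above 1 keep the dilates from shrinking, ratios at most 2 keep them in a common ball. *)
move=> [cF lF] Fq; pose lam (i : nat) : R := 1 + i.+1%:R^-1.
have lam1 i : 1 < lam i by rewrite /lam ltrDl invr_gt0.
have lam0 i : 0 < lam i by have := lam1 i; lra.
have lam2 i : lam i <= 2 by rewrite /lam lerD2l invf_le1// ler1n.
pose Z := [set x | F x = 0].
pose dil (l : R) x := l *: (x - q) + q.
have cdil l : continuous (dil l).
  move=> x; apply: (lip_continuous_at ltr01 (K := `|l|)) => y _.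
  by rewrite /dil opprD addrACA subrr addr0 -scalerBr opprB addrA subrK normrZ.
(* On [S j] both the distance to [q] and the index from which dilation leaves the zero set are
   uniform. *)
pose S j := [set x | [/\ Z x, `|x - q| <= j%:R &
  forall i i', (j <= i)%N -> (j <= i')%N -> i != i' -> ~ Z (dil (lam i / lam i') x)]].
apply: (@outer_null_subset _ _ _ (\bigcup_j S j)).
  move=> x Zx.
  have lx : analytic1 (fun t => F (dil t x)) by have := lF q (x - q).
  have Fq' : F (dil 0 x) != 0 by rewrite /dil scale0r add0r.
  have [e e0 xe] := analytic1_isolated lx Fq' 1.
  (* The second entry gives 1/(j+1) < e, so ratios of later terms of [lam] differ from 1 by less
     than the isolation radius [e]. *)
  pose j := maxn (Num.truncn `|x - q|).+1 (Num.truncn e^-1).+1.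
  exists j => //; split=> //.
    by apply: le_trans (ltW (truncnS_gt _)) _; rewrite ler_nat leq_maxl.
  have je : j.+1%:R^-1 < e.
    rewrite invf_plt ?posrE//; apply: lt_le_trans (truncnS_gt _) _.
    by rewrite ler_nat ltnW// ltnS leq_maxr.
  have lamj i : (j <= i)%N -> lam i < 1 + e.
    move=> ji; rewrite ltrD2l; apply: le_lt_trans je.
    by rewrite lef_pV2 ?posrE// ler_nat ltnS.
  move=> i i' ji ji' ii' /eqP; apply/negP.
  have -> : lam i / lam i' = 1 + (lam i / lam i' - 1) by rewrite addrC subrK.
  apply: xe.
    rewrite normr_gt0 subr_eq0; apply: contra ii' => /eqP h.
    have : lam i = lam i' by rewrite -[RHS]mul1r -h divfK// gt_eqF.
    by move=> /addrI /invr_inj /eqP; rewrite eqr_nat eqSS.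
  have -> : lam i / lam i' - 1 = (lam i - lam i') / lam i'.
    by field; rewrite gt_eqF.
  rewrite normrM normfV [`|lam i'|]gtr0_norm// ltr_pdivrMr//.
  apply: (@lt_trans _ _ e); last by rewrite ltr_pMr.
  rewrite ltr_norml; have := lamj _ ji; have := lamj _ ji'.
  by have := lam1 i; have := lam1 i'; move=> *; apply/andP; split; lra.
apply: outer_null_bigcup => j.
have bZC : borel_set (~` Z).
  apply: borel_open; have -> : ~` Z = F @^-1` [set y | y != 0].
    by apply/seteqP; split=> x /= /eqP.
  by apply: open_comp; [move=> x _; exact: cF|exact: open_neq].
have bdil l A : borel_set A -> borel_set (dil l @^-1` A).
  move=> bA; rewrite -[_ @^-1` _]setTI.
  by apply: (borel_preimage_open openT _ bA) => x _; exact: cdil.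
have bS : borel_set (S j).
  have -> : S j = Z `&` [set x | `|x - q| <= j%:R] `&` \bigcap_i \bigcap_i'
      (if [&& j <= i, j <= i' & i != i']%N then dil (lam i / lam i') @^-1` (~` Z) else setT).
    apply/seteqP; split=> x.
      by move=> [? ? h]; split=> // i _ i' _; case: ifP => // /and3P[? ? ?]; exact: h.
    move=> [[? ?] h]; split=> // i i' ji ji' ii'.
    by have := h i I i' I; rewrite ji ji' ii'.
  apply: borel_setI; first apply: borel_setI.
  - by rewrite -[Z]setCK; exact: borel_setC.
  - rewrite -[X in borel_set X]setCK; apply: borel_setC; apply: borel_open.
    have -> : ~` [set x | `|x - q| <= j%:R] = (fun x => `|x - q|) @^-1` [set y | j%:R < y].
      by apply/seteqP; split=> x /= h; [rewrite ltNge; exact/negP|apply/negP; rewrite -ltNge].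
    apply: open_comp; last exact: open_gt.
    move=> x _; apply: (@lip_continuous_at _ _ R^o _ _ _ 1 ltr01) => y _.
    rewrite mul1r; apply: le_trans (ler_dist_dist _ _) _.
    by rewrite opprB addrA subrK.
  - apply: borel_bigcap => i; apply: borel_bigcap => i'; case: ifP => _.
      exact: bdil.
    exact: borel_open openT.
have dilK l l' x : 0 < l -> 0 < l' -> dil l (dil l' x) = dil (l * l') x.
  by move=> l0 l'0; rewrite /dil addrK scalerA.
apply: (@packing_null _ _ _ (fun i => dil (lam (j + i)%N) @` S j) (2 * j%:R + `|q|)).
- move=> i; apply: borel_caratheodory.
  have -> : dil (lam (j + i)%N) @` S j = dil (lam (j + i)%N)^-1 @^-1` S j.
    apply/seteqP; split=> x.
      move=> [y Sy <-] /=; rewrite dilK ?invr_gt0// mulVf ?gt_eqF//.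
      by rewrite /dil scale1r subrK.
    move=> /= Sx; eexists; first exact: Sx.
    by rewrite dilK ?invr_gt0// mulfV ?gt_eqF// /dil scale1r subrK.
  exact: bdil.
(* A common point of two dilates would exhibit the zero [x] as the dilate of [x'] by a ratio that
   the definition of [S j] forbids. *)
- apply/trivIsetP => i i' _ _ ii'; rewrite -subset0 => _ [[x Sx <-] [x' Sx' xx']].
  case: Sx => Zx _ _; case: Sx' => _ _ /(_ (j + i')%N (j + i)%N); rewrite !leq_addr eqn_add2l.
  rewrite eq_sym ii' => /(_ isT isT isT); apply.
  suff -> : dil (lam (j + i')%N / lam (j + i)%N) x' = x by [].
  rewrite mulrC -dilK ?invr_gt0// xx' dilK ?invr_gt0// mulVf ?gt_eqF//.
  by rewrite /dil scale1r subrK.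
- move=> i; apply: le_trans (lebesgue_outer_affine _ (q - lam (j + i)%N *: q) (ltW (lam1 _))) _.
  apply: le_lebesgue_outer => _ [x Sx <-]; exists x; first exact: Sx.
  by rewrite /dil scalerBr addrA addrAC.
- move=> i _ [x [_ xj _] <-] /=; rewrite /dil; apply: le_trans (ler_normD _ _) _.
  by rewrite lerD2r normrZ gtr0_norm// ler_pM// ltW.
Qed.

End NullSets.

(** * Differentials and fibres of constant rank *)

HB.instance Definition _ (R : realType) m n := Complete.on 'M[R]_(m, n).

Section Differential.
Variable R : realType.

Lemma mulmx_norm_le s n (v : 'rV[R]_s) (A : 'M[R]_(s, n)) (C : R) : 0 <= C ->
  (forall i j, `|A i j| <= C) -> `|v *m A| <= s%:R * C * `|v|.
Proof.
move=> C0 AC; apply: rV_norm_le => [|j]; first by rewrite !mulr_ge0.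
rewrite mxE; apply: le_trans (ler_norm_sum _ _ _) _.
apply: (@le_trans _ _ (\sum_(i < s) C * `|v|)); last first.
  by rewrite sumr_const card_ord -[leLHS]mulr_natl mulrA.
by apply: ler_sum => i _; rewrite normrM mulrC ler_pM// rV_coord_le.
Qed.

Lemma mulmx_bounded s n (A : 'M[R]_(s, n)) :
  exists2 C, 0 <= C & forall v : 'rV[R]_s, `|v *m A| <= C * `|v|.
Proof.
exists (s%:R * \sum_i \sum_j `|A i j|) => [|v].
  by rewrite mulr_ge0// sumr_ge0// => i _; rewrite sumr_ge0.
apply: mulmx_norm_le => [|i j].
  by apply: sumr_ge0 => i _; rewrite sumr_ge0.
rewrite (bigD1 i)//= (bigD1 j)//= -addrA lerDl addr_ge0// ?sumr_ge0// => k _.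
by rewrite sumr_ge0.
Qed.

(** The expansion is uniform in the base point [x] near [x0], which the chain rule and [strict_diff]
    both use. Vectors are rows, so [J] is the transposed Jacobian matrix. *)
Definition quad_diff s n (g : 'rV[R]_s -> 'rV[R]_n) (J : 'rV[R]_s -> 'M[R]_(s, n)) :=
  forall x0, exists d K, [/\ 0 < d, 0 <= K & forall x y, `|x - x0| < d -> `|y - x0| < d ->
    [/\ `|g y - g x - (y - x) *m J x| <= K * `|y - x| ^+ 2,
        `|g y - g x| <= K * `|y - x| & forall i j, `|J x i j| <= K]].

Definition jac s n (g : 'rV[R]_s -> 'rV[R]_n) x : 'M[R]_(s, n) :=
  \matrix_(i, j) pd (fun x => g x 0 j) i x.

Lemma fin_max (I : finType) (K : I -> R) : exists2 C, 0 <= C & forall i, K i <= C.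
Proof.
exists (\big[Num.max/0]_i K i); last by move=> i; exact: le_bigmax.
exact: bigmax_ge_id.
Qed.

Lemma analytic_quad_diff s n (g : 'rV[R]_s -> 'rV[R]_n) :
  real_analytic g -> quad_diff g (jac g).
Proof.
move=> ga x0.
have /choice[d /choice[K Hd]] := fun j => analytic_quad (ga j) x0.
have [e e0 ed] := fin_min (fun j => let: And3 h _ _ := Hd j in h).
have [C C0 KC] := fin_max K.
have [C2 C20 bC2] := fin_max (fun ij : 'I_s * 'I_n =>
  `|pd (fun x => g x 0 ij.2) ij.1 x0| + C * e).
exists e, (C + C2); split=> //; first exact: addr_ge0.
move=> x y xe ye; split.
- apply: rV_norm_le => [|j]; first by rewrite mulr_ge0 ?exprn_ge0 ?addr_ge0.
  have [_ _ /(_ x y (lt_le_trans xe (ed j)) (lt_le_trans ye (ed j)))] := Hd j.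
  have -> : (g y - g x - (y - x) *m jac g x) 0 j =
      g y 0 j - g x 0 j - \sum_(i < s) (y - x) 0 i * pd (fun x => g x 0 j) i x.
    by rewrite !mxE; congr (_ - _); apply: eq_bigr => i _; rewrite [jac g x i j]mxE.
  move=> [+ _ _] => /le_trans; apply; rewrite ler_wpM2r ?exprn_ge0//.
  by apply: le_trans (KC j) _; rewrite lerDl.
- apply: rV_norm_le => [|j]; first by rewrite mulr_ge0 ?addr_ge0.
  have [_ _ /(_ x y (lt_le_trans xe (ed j)) (lt_le_trans ye (ed j)))] := Hd j.
  move=> [_ + _]; rewrite !mxE => /le_trans; apply; rewrite ler_wpM2r//.
  by apply: le_trans (KC j) _; rewrite lerDl.
- move=> i j; rewrite mxE.
  have x00 : `|x0 - x0| < d j by rewrite subrr normr0; have [] := Hd j.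
  have [_ _ /(_ x0 x x00 (lt_le_trans xe (ed j)))] := Hd j.
  move=> [_ _ /(_ i) h]; have /= b2 := bC2 (i, j).
  have h2 : K j * `|x - x0| <= C * e.
    apply: (@le_trans _ _ (C * `|x - x0|)); first by rewrite ler_wpM2r.
    by rewrite ler_wpM2l// ltW.
  set u := pd _ i x in h *; set v := pd _ i x0 in h b2.
  have -> : u = v + (u - v) by ring.
  by apply: le_trans (ler_normD _ _) _; lra.
Qed.

Lemma quad_diff_comp s m n (h : 'rV[R]_s -> 'rV[R]_m) (f : 'rV[R]_m -> 'rV[R]_n) J J' :
  quad_diff h J -> quad_diff f J' ->
  quad_diff (f \o h) (fun x => J x *m J' (h x)).
Proof.
move=> qh qf x0; have [d [K [d0 K0 H]]] := qh x0.
have [e [L [e0 L0 H']]] := qf (h x0).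
have x00 : `|x0 - x0| < d by rewrite subrr normr0.
(* The first two terms bound the quadratic remainder, the third the increment, the last the entries
   of the product matrix. *)
pose C := L * K ^+ 2 + m%:R * L * K + L * K + m%:R * K * L.
have mL0 : 0 <= m%:R * L by rewrite mulr_ge0.
have LK0 : 0 <= L * K by rewrite mulr_ge0.
have LK20 : 0 <= L * K ^+ 2 by rewrite mulr_ge0// exprn_ge0.
have mLK0 : 0 <= m%:R * L * K by rewrite mulr_ge0.
have mKL0 : 0 <= m%:R * K * L by rewrite !mulr_ge0.
exists (Num.min d (e / (K + 1))), C; split; first by rewrite lt_min d0 divr_gt0//; lra.
  by rewrite /C; lra.
have near_h x : `|x - x0| < Num.min d (e / (K + 1)) -> `|x - x0| < d /\ `|h x - h x0| < e.
  rewrite lt_min => /andP[xd xe]; split=> //.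
  have [_ hx _] := H x0 x x00 xd; apply: le_lt_trans hx _.
  have : `|x - x0| * (K + 1) < e by rewrite -ltr_pdivlMr//; lra.
  by apply: le_lt_trans; rewrite mulrC ler_wpM2l//; lra.
move=> x y /near_h[xd xe] /near_h[yd ye].
have [h1 h2 h3] := H x y xd yd; have [f1 f2 f3] := H' _ _ xe ye.
have n2 : 0 <= `|y - x| ^+ 2 by rewrite exprn_ge0.
have n1 := normr_ge0 (y - x).
split.
- have -> : (f \o h) y - (f \o h) x - (y - x) *m (J x *m J' (h x)) =
    (f (h y) - f (h x) - (h y - h x) *m J' (h x)) +
    (h y - h x - (y - x) *m J x) *m J' (h x).
    by rewrite /= [X in _ = _ + X]mulmxBl mulmxA addrA subrK.
  apply: le_trans (ler_normD _ _) _.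
  have b1 : `|f (h y) - f (h x) - (h y - h x) *m J' (h x)| <= L * K ^+ 2 * `|y - x| ^+ 2.
    apply: le_trans f1 _; rewrite -mulrA -exprMn ler_wpM2l//.
    by rewrite lerXn2r ?nnegrE ?mulr_ge0.
  have b2 : `|(h y - h x - (y - x) *m J x) *m J' (h x)| <= m%:R * L * K * `|y - x| ^+ 2.
    by apply: le_trans (mulmx_norm_le _ L0 f3) _; rewrite -[leRHS]mulrA ler_wpM2l.
  apply: le_trans (lerD b1 b2) _; rewrite -mulrDl ler_wpM2r// /C; lra.
- apply: (@le_trans _ _ (L * K * `|y - x|)); last by rewrite ler_wpM2r// /C; lra.
  by apply: le_trans f2 _; rewrite -mulrA ler_wpM2l.
- move=> i j; rewrite mxE; apply: le_trans (ler_norm_sum _ _ _) _.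
  apply: (@le_trans _ _ (\sum_(k < m) K * L)).
    by apply: ler_sum => k _; rewrite normrM ler_pM.
  by rewrite sumr_const card_ord -[leLHS]mulr_natl mulrA /C; lra.
Qed.

Lemma strict_diff s n (g : 'rV[R]_s -> 'rV[R]_n) J p (e : R) : quad_diff g J ->
  (forall i j, continuous (fun x => J x i j)) -> 0 < e ->
  exists2 d, 0 < d & forall x y, `|x - p| <= d -> `|y - p| <= d ->
    `|g y - g x - (y - x) *m J p| <= e * `|y - x|.
Proof.
move=> qg cJ e0; have [d [K [d0 K0 H]]] := qg p.
(* Half of [e] is reserved for the variation of [J], where multiplication by a matrix costs a factor
   [s]; the other half is for the quadratic remainder. *)
pose e1 := e / (2 * (s%:R + 1)).
have s0 : 0 <= s%:R :> R by [].
have e10 : 0 < e1 by rewrite divr_gt0//; lra.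
have [d1 /= d10 Jd1] : exists2 d1 : R, 0 < d1 &
    forall x, `|x - p| < d1 -> forall i j, `|J x i j - J p i j| <= e1.
  have /filter_forall H1 : forall ij : 'I_s * 'I_n,
      \forall x \near p, `|J p ij.1 ij.2 - J x ij.1 ij.2| <= e1.
    move=> ij; move: (cJ ij.1 ij.2 p).
    by move=> /(@cvgrPdist_le _ _ _ (nbhs p) (nbhs_filter p)) /(_ e1 e10).
  have /nbhs_ballP[d1 d10 Hd1] := H1.
  exists d1 => // x /rV_ballE xd i j.
  by rewrite distrC; exact: (Hd1 x xd (i, j)).
pose d2 := Num.min (d / 2) (Num.min (d1 / 2) (e / (4 * (K + 1)))).
exists d2; first by rewrite !lt_min; apply/and3P; split; [lra|lra|rewrite divr_gt0//; lra].
move=> x y; rewrite !le_min => /and3P[xd xd1 xe] /and3P[yd yd1 ye].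
have xd' : `|x - p| < d by lra.
have yd' : `|y - p| < d by lra.
have [h1 _ _] := H x y xd' yd'.
have -> : g y - g x - (y - x) *m J p =
  (g y - g x - (y - x) *m J x) + (y - x) *m (J x - J p).
  by rewrite mulmxBr addrA subrK.
apply: le_trans (ler_normD _ _) _.
have b2 : `|(y - x) *m (J x - J p)| <= e / 2 * `|y - x|.
  apply: le_trans (mulmx_norm_le (C := e1) _ (ltW e10) _) _.
    by move=> i j; rewrite !mxE; apply: Jd1; lra.
  rewrite ler_wpM2r// /e1 mulrA ler_pdivrMr; last by lra.
  have -> : e / 2 * (2 * (s%:R + 1)) = s%:R * e + e by field.
  lra.
have b1 : K * `|y - x| ^+ 2 <= e / 2 * `|y - x|.
  rewrite expr2 mulrA ler_wpM2r//.
  have yx : `|y - x| <= `|y - p| + `|x - p|.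
    have -> : y - x = (y - p) - (x - p) by rewrite opprB addrA subrK.
    exact: ler_normB.
  have yx2 : `|y - x| <= e / (2 * (K + 1)).
    apply: le_trans yx _; apply: le_trans (lerD ye xe) _.
    rewrite le_eqVlt; apply/orP; left; apply/eqP; field; lra.
  move: yx2; rewrite ler_pdivlMr; last by lra.
  have := normr_ge0 (y - x); set z := `|y - x| => z0 h.
  have : K * z <= (K + 1) * z by rewrite ler_wpM2r//; lra.
  lra.
have := le_trans h1 b1; lra.
Qed.

(** Second-order increments force a zero derivative on the closed interval, whence the mean value
    theorem applies. The constants may vary with [t]. *)
Lemma quad_const (u : R -> R) :
  (forall t : R, 0 <= t <= 1 -> exists d C : R, 0 < d /\
     forall e : R, `|e| < d -> `|u (e + t) - u t| <= C * e ^+ 2) -> u 0 = u 1.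
Proof.
move=> H.
have du (t : R) : t \in `[0, 1] -> is_derive t (1 : R) u 0.
  rewrite in_itv/= => /H[d [C [d0 Hd]]].
  apply: (@is_derive_quad R R^o R^o u t _ _ d C d0) => e ed.
  by have := Hd e ed; rewrite /GRing.scale/= mulr1 mulr0 subr0.
have du' (t : R) : t \in `]0, 1[ -> is_derive t (1 : R) u 0.
  by rewrite in_itv/= => /andP[t0 t1]; apply: du; rewrite in_itv/= !ltW.
have cu : {within `[0, 1], continuous u}.
  by apply: derivable_within_continuous => t /du [].
have [c _] := MVT_segment ler01 du' cu.
by rewrite mul0r => /eqP; rewrite subr_eq0 eq_sym => /eqP.
Qed.

(** Solving [P x = w] means finding a fixed point of [x - P x + w], a contraction of ratio 1/2. It
    preserves the closed ball because [w] moves its centre by at most [d / 2]. *)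
Lemma near_id_inverse s (P : 'rV[R]_s -> 'rV[R]_s) p (d : R) : 0 < d ->
  (forall x y, `|x - p| <= d -> `|y - p| <= d ->
     `|P y - P x - (y - x)| <= 2^-1 * `|y - x|) ->
  exists Q : 'rV[R]_s -> 'rV[R]_s, forall w, `|w - P p| <= d / 2 ->
    `|Q w - p| <= d /\ P (Q w) = w.
Proof.
move=> d0 HP.
suff /choice[Q HQ] : forall w, exists x, `|w - P p| <= d / 2 -> `|x - p| <= d /\ P x = w.
  by exists Q.
move=> w; have [wd|wd] := pselect (`|w - P p| <= d / 2); last by exists 0.
pose U := [set x : 'rV[R]_s | `|x - p| <= d].
pose F x := x - P x + w.
have p00 : `|p - p| <= d by rewrite subrr normr0 ltW.
have FF x y : F x - F y = - (P x - P y - (x - y)).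
  by apply/rowP => i; rewrite !mxE; ring.
have FU : set_fun U U F.
  move=> x Ux; suff : `|F x - p| <= d by [].
  have -> : F x - p = (F x - F p) + (w - P p).
    by apply/rowP => i; rewrite !mxE; ring.
  apply: le_trans (ler_normD _ _) _; rewrite FF normrN.
  by have := HP p x p00 Ux; move: Ux; rewrite /U/= => *; lra.
have ctr : is_contraction (mkfun FU).
  have h0 : 0 <= 2^-1 :> R by rewrite invr_ge0.
  exists (NngNum h0); split=> /=; first by rewrite invf_lt1// ltr1n.
  move=> [x y] [/= Ux Uy]; rewrite FF normrN.
  exact: HP.
have clU : closed U.
  have -> : U = closed_ball p d.
    by rewrite closed_ballE//; apply/seteqP; split=> x; rewrite /U /closed_ball_/= distrC.
  exact: closed_ball_closed.
have [|x Ux xF] := banach_fixed_point ctr clU; first by exists p.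
exists x => _; split=> //; move: xF; rewrite /= /F => /eqP.
rewrite -subr_eq0 => /eqP h; apply/eqP; rewrite -subr_eq0 -h.
by apply/eqP/rowP => i; rewrite !mxE; ring.
Qed.

End Differential.

(** * Straightening the fibres near a point of constant rank *)

Section LocalFibres.
Variables (R : realType) (s' : nat).
Let s := s'.+1.
Variables (n r : nat) (g : 'rV[R]_s -> 'rV[R]_n) (J : 'rV[R]_s -> 'M[R]_(s, n)).
Variables (U : 'M[R]_(n, r)) (B : 'M[R]_(r, s)) (p : 'rV[R]_s) (d : R).
Hypothesis gJ : quad_diff g J.
Hypothesis cJ : forall i j, continuous (fun x => J x i j).
Hypothesis BJU : B *m J p *m U = 1%:M.
Hypothesis d0 : 0 < d.
(** Constant rank in usable form: a row vector killed by [J x *m U] is already killed by [J x]. *)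
Hypothesis JU : forall x, `|x - p| < d -> exists L : 'M[R]_(r, n), J x = J x *m U *m L.

(* [g x *m U] is read off from [straighten x] by the fixed linear map
   [J p *m U]; the correction makes the derivative at [p] the identity. *)
Definition straighten x := x - x *m (J p *m U *m B) + g x *m U *m B.

Lemma straighten_near_id : exists2 e, 0 < e <= d / 2 & forall x y, `|x - p| <= e ->
  `|y - p| <= e -> `|straighten y - straighten x - (y - x)| <= 2^-1 * `|y - x|.
Proof.
have [C C0 HC] := mulmx_bounded (U *m B).
have e0 : 0 < (2 * (C + 1))^-1 by rewrite invr_gt0; lra.
have [d1 d10 Hd1] := strict_diff p gJ cJ e0.
exists (Num.min d1 (d / 2)).
  by rewrite lt_min d10 ge_min lexx orbT /= andbT divr_gt0.
move=> x y; rewrite !le_min => /andP[xd _] /andP[yd _].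
have -> : straighten y - straighten x - (y - x) =
    (g y - g x - (y - x) *m J p) *m (U *m B).
  rewrite /straighten !mulmxBl !mulmxA.
  move: (y *m J p *m U *m B) (x *m J p *m U *m B) (g y *m U *m B) (g x *m U *m B).
  by move=> a b c e; apply/rowP => i; rewrite !mxE; ring.
apply: le_trans (HC _) _.
apply: le_trans (ler_wpM2l C0 (Hd1 _ _ xd yd)) _.
rewrite mulrA ler_wpM2r// ler_pdivrMr; last by lra.
by rewrite mulrA mulVf ?mul1r//; lra.
Qed.

(** [B] is a left inverse of [J p *m U], so the linear terms cancel. Moving [straighten x] along the
    kernel of [J p *m U] therefore leaves [g x *m U] unchanged. *)
Lemma straighten_mul x : straighten x *m (J p *m U) = g x *m U.
Proof.
have BM : B *m (J p *m U) = 1%:M by rewrite mulmxA.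
rewrite /straighten mulmxDl mulmxBl -(mulmxA x) -(mulmxA _ B) BM mulmx1 subrr add0r.
by rewrite -mulmxA BM mulmx1.
Qed.

Lemma fibre_null (A : set 'rV[R]_s) : (r < s)%N -> borel_set A ->
  (forall x y, A x -> A y -> `|x - p| < d -> `|y - p| < d -> g x = g y -> x = y) ->
  exists2 e : R, 0 < e & lebesgue_outer (A `&` ball p e) = 0%E.
Proof.
move=> rs bA gA; set P := straighten.
have [k k0 kM] : exists2 k : 'rV[R]_s, k != 0 & k *m (J p *m U) = 0.
  have : kermx (J p *m U) != 0.
    rewrite -mxrank_eq0 mxrank_ker subn_eq0 -ltnNge.
    exact: leq_ltn_trans (rank_leq_col _) rs.
  by move=> /rowV0Pn[k /sub_kermxP kk k0]; exists k.
have [dl /andP[dl0 dld] HP] := straighten_near_id; rewrite -/P in HP.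
have [Q HQ] := near_id_inverse dl0 HP.
have pp : `|p - p| <= dl by rewrite subrr normr0 ltW.
have bilip x y : `|x - p| <= dl -> `|y - p| <= dl -> `|y - x| <= 2 * `|P y - P x|.
  move=> xd yd; have := HP x y xd yd.
  have : `|y - x| <= `|P y - P x| + `|P y - P x - (y - x)|.
    by apply: le_trans (ler_normB _ _); rewrite subKr.
  lra.
have lipP x : `|x - p| <= dl -> `|P x - P p| <= 3 / 2 * `|x - p|.
  move=> xd; have := HP p x pp xd.
  have : `|P x - P p| <= `|x - p| + `|P x - P p - (x - p)|.
    by apply: le_trans (ler_normD _ _); rewrite subrKC.
  lra.
have QL w w' : `|w - P p| <= dl / 2 -> `|w' - P p| <= dl / 2 ->
    `|Q w - Q w'| <= 2 * `|w - w'|.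
  move=> /HQ[wd PQ] /HQ[wd' PQ'].
  by have := bilip _ _ wd' wd; rewrite PQ PQ'.
(* [P] expands distances from [p] by at most 3/2, so images stay within [dl / 4] of [P p], half the
   radius on which [Q] inverts [P]. *)
pose e := dl / 6.
have Pe x : `|x - p| < e -> `|P x - P p| <= dl / 4.
  rewrite /e => xe; have xd : `|x - p| <= dl by lra.
  by have := lipP x xd; lra.
have QP x : `|x - p| < e -> Q (P x) = x.
  move=> xe; have xd : `|x - p| <= dl by move: xe; rewrite /e; lra.
  have Px : `|P x - P p| <= dl / 2 by have := Pe x xe; lra.
  have [Qd PQ] := HQ _ Px; apply/eqP; rewrite -subr_eq0 -normr_le0.
  by have := bilip _ _ xd Qd; rewrite PQ subrr normr0 mulr0.
(* The segment from [P x] to [P x'] is pulled back by [Q]; along the resulting curve the increments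
   of [g] are of second order, so [quad_const] applies. *)
have fibre x x' (c : R) : `|x - p| < e -> `|x' - p| < e -> P x' - P x = c *: k ->
    g x = g x'.
  move=> xe xe' xx'; pose w t := t *: (c *: k) + P x.
  have w0 : w 0 = P x by rewrite /w scale0r add0r.
  have w1 : w 1 = P x' by rewrite /w scale1r -xx' subrK.
  have wd t : 0 <= t <= 1 -> `|w t - P p| <= dl / 4.
    move=> /andP[t0 t1].
    have -> : w t - P p = (1 - t) *: (P x - P p) + t *: (P x' - P p).
      by rewrite /w -xx'; apply/rowP => i; rewrite !mxE; ring.
    apply: le_trans (ler_normD _ _) _; rewrite !normrZ ger0_norm ?subr_ge0//.
    rewrite (ger0_norm t0).
    have h1 := ler_wpM2l (_ : 0 <= 1 - t) (Pe x xe); rewrite subr_ge0 in h1.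
    have h2 := ler_wpM2l t0 (Pe x' xe').
    by have := lerD (h1 t1) h2; lra.
  rewrite -(QP x xe) -(QP x' xe') -w0 -w1; apply/rowP => j.
  apply: (@quad_const R (fun t => g (Q (w t)) 0 j)) => t t01.
  have wt4 := wd t t01; have wt : `|w t - P p| <= dl / 2 by lra.
  have [yd Py] := HQ _ wt; set y := Q (w t) in yd Py *.
  have [|L JL] := JU (x := y); first by lra.
  have [dq [K [dq0 K0 Hq]]] := gJ y.
  have [CU CU0 HU] := mulmx_bounded U; have [CL CL0 HL] := mulmx_bounded L.
  pose v := c *: k; have v0 := normr_ge0 v.
  (* The first entry keeps the perturbed point in the domain of [Q]; the second keeps [z] in the
     range of the expansion at [y], as [Q] is 2-Lipschitz. *)
  pose q := Num.min (dl / 4) (dq / 2).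
  have q0 : 0 < q by rewrite lt_min; apply/andP; split; lra.
  have qv : 0 < q / (`|v| + 1) by rewrite divr_gt0//; lra.
  exists (q / (`|v| + 1)), ((K + CL * CU * K) * (2 * `|v|) ^+ 2); split=> // a.
  rewrite ltr_pdivlMr; last by lra.
  move=> aq; have aq' : `|a| * `|v| < q.
    by apply: le_lt_trans aq; rewrite ler_wpM2l//; lra.
  move: aq'; rewrite lt_min => /andP[av4 avq].
  have ww : w (a + t) - w t = a *: v by rewrite /w -/v; apply/rowP => i; rewrite !mxE; ring.
  have wat : `|w (a + t) - P p| <= dl / 2.
    have -> : w (a + t) - P p = (w (a + t) - w t) + (w t - P p) by rewrite addrA subrK.
    by apply: le_trans (ler_normD _ _) _; rewrite ww normrZ; lra.
  have [zd Pz] := HQ _ wat; set z := Q (w (a + t)) in zd Pz *.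
  have zy : `|z - y| <= 2 * `|v| * `|a|.
    by have := QL _ _ wat wt; rewrite ww normrZ [`|a| * _]mulrC mulrA.
  have zq : `|z - y| < dq.
    by apply: le_lt_trans zy _; rewrite -mulrA (mulrC `|v|); lra.
  have yy : `|y - y| < dq by rewrite subrr normr0.
  have [quad _ _] := Hq y z yy zq; set rem := g z - g y - _ in quad.
  have gU : g z *m U = g y *m U.
    rewrite -!straighten_mul -/P Pz Py; apply/eqP; rewrite -subr_eq0 -mulmxBl ww /v.
    by rewrite scalerA -scalemxAl kM scaler0.
  (* As [g *m U] does not change, the linear term seen through [U] equals minus the remainder, hence
     is of second order; the factor [L] carries this over to all of [J y]. *)
  have JUr : (z - y) *m J y *m U = - (rem *m U).
    rewrite /rem !mulmxBl gU subrr sub0r opprK.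
    by rewrite -!mulmxBl.
  have zJ : `|(z - y) *m J y| <= CL * (CU * (K * `|z - y| ^+ 2)).
    rewrite JL !mulmxA JUr; apply: le_trans (HL _) _; rewrite ler_wpM2l// normrN.
    by apply: le_trans (HU _) _; rewrite ler_wpM2l.
  have gzy : `|g z - g y| <= (K + CL * CU * K) * `|z - y| ^+ 2.
    have -> : g z - g y = rem + (z - y) *m J y by rewrite /rem subrK.
    apply: le_trans (ler_normD _ _) _; rewrite [leRHS]mulrDl lerD//.
    by rewrite -!mulrA.
  apply: (@le_trans _ _ `|g z - g y|).
    by have := rV_coord_le (g z - g y) j; rewrite !mxE.
  apply: le_trans gzy _; rewrite -[leRHS]mulrA ler_wpM2l ?addr_ge0 ?mulr_ge0//.
  by rewrite -[a ^+ 2]real_normK ?num_real// -exprMn lerXn2r ?nnegrE ?mulr_ge0.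
have e0 : 0 < e by rewrite /e; lra.
have ed : e < d by rewrite /e; lra.
exists e => //; set A0 := A `&` ball p e.
have bA0 : borel_set A0 by apply: borel_setI => //; apply: borel_open; exact: ball_open.
have A0e x : A0 x -> `|x - p| < e by move=> [_ /rV_ballE].
pose At := P @` A0.
have Atd w : At w -> `|w - P p| <= dl / 2.
  by move=> [x /A0e xe <-]; have := Pe x xe; lra.
have bAt : borel_set At.
  (* Writing the image under [P] as a preimage under the continuous inverse [Q] makes it Borel. *)
  have -> : At = ball (P p) (dl / 2) `&` Q @^-1` A0.
    apply/seteqP; split=> w.
      move=> [x A0x <-]; have xe := A0e x A0x; split; last by rewrite /= QP.
      by apply/rV_ballE; have := Pe x xe; lra.
    move=> [/rV_ballE/ltW wd A0w]; have [_ PQ] := HQ w wd.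
    by exists (Q w).
  apply: (borel_preimage_open (ball_open _ _) _ bA0) => w /rV_ballE wd.
  have w0 : 0 < dl / 2 - `|w - P p| by rewrite subr_gt0.
  apply: (lip_continuous_at w0 (K := 2)) => y yw; apply: QL; last exact: ltW.
  have -> : y - P p = (y - w) + (w - P p) by rewrite addrA subrK.
  by apply: le_trans (ler_normD _ _) _; lra.
have At0 : lebesgue_outer At = 0%E.
  pose tr (i : nat) : R := i.+1%:R^-1.
  apply: (@packing_null _ _ _ (fun i => [set (1 *: w + tr i *: k)%R | w in At])
     (`|P p| + dl + `|k|)).
  - move=> i; apply: borel_caratheodory.
    have -> : [set (1 *: w + tr i *: k)%R | w in At] =
        setT `&` (fun w => w - tr i *: k) @^-1` At.
      rewrite setTI; apply/seteqP; split=> w.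
        by move=> [y Aty <-]; rewrite /= scale1r addrK.
      by move=> /= Aty; eexists; first exact: Aty; rewrite scale1r subrK.
    apply: (borel_preimage_open openT _ bAt) => w _; apply: (lip_continuous_at ltr01 (K := 1)) => y _.
    by rewrite opprB addrA subrK mul1r.
  (* If two translates meet, [x] and [x'] lie on one fibre, so injectivity gives [x = x']; as [k] is
     nonzero, the two shifts coincide. *)
  - move=> i i' _ _ [_ [[_ [x A0x <-] <-] [_ [x' A0x' <-]]]].
    rewrite !scale1r => xx'.
    have PP : P x' - P x = (tr i - tr i') *: k.
      have -> : P x' = P x + tr i *: k - tr i' *: k by rewrite -xx' addrK.
      by rewrite scalerBl addrAC (addrC (P x)) addrK.
    have xe := A0e x A0x; have xe' := A0e x' A0x'.
    have xd : `|x - p| < d by lra.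
    have xd' : `|x' - p| < d by lra.
    have := gA x x' A0x.1 A0x'.1 xd xd' (fibre x x' _ xe xe' PP).
    move=> xE; move: PP; rewrite xE subrr => /esym/eqP; rewrite scaler_eq0 (negbTE k0) orbF.
    by rewrite subr_eq0 => /eqP /invr_inj /eqP; rewrite eqr_nat eqSS => /eqP.
  - by move=> i; apply: lebesgue_outer_affine.
  - move=> i _ [w Atw <-] /=; rewrite scale1r; apply: le_trans (ler_normD _ _) _.
    apply: lerD.
      have -> : w = P p + (w - P p) by rewrite addrC subrK.
      by apply: le_trans (ler_normD _ _) _; have := Atd w Atw; lra.
    rewrite normrZ ger0_norm ?invr_ge0// -[leRHS]mul1r ler_wpM2r//.
    by rewrite invf_le1// ler1n.
apply: (@outer_null_subset _ _ _ (Q @` At)).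
  by move=> x A0x; exists (P x); [exists x|rewrite QP//; exact: A0e].
apply: (@lip_null _ _ At Q 2) => // w w' Atw Atw'.
by apply: QL; exact: Atd.
Qed.

End LocalFibres.

(** * Local injectivity, rank factorisation and the conclusion *)

Section Assembly.
Variable R : realType.

Lemma Dmat_jac s m (h : 'rV[R]_s -> 'rV[R]_m) v : real_analytic h ->
  Dmat h v = (jac h v)^T.
Proof.
move=> ha; apply/matrixP => i j; rewrite [LHS]mxE [RHS]mxE.
have [d [K [d0 K0 H]]] := analytic_quad_diff ha v.
have vv : `|v - v| < d by rewrite subrr normr0.
have [_ ->] : is_derive v (delta_mx 0 j) h (row j (jac h v)).
  apply: (is_derive_quad (K := K) d0) => t td.
  have tj : `|t *: unit_row R j + v - v| <= `|t|.
    by rewrite addrK normrZ -[leRHS]mulr1 ler_wpM2l// unit_row_norm.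
  have [quad _ _] := H v _ vv (le_lt_trans tj td).
  rewrite rowE scalemxAl -/(unit_row R j).
  rewrite addrK in quad tj; apply: le_trans quad _; rewrite ler_wpM2l//.
  by rewrite -[t ^+ 2]real_normK ?num_real// lerXn2r ?nnegrE.
by rewrite mxE.
Qed.

(** An invertible Gram matrix gives [J] a right inverse of norm at most [C]. If [h x = h y], strict
    differentiability with constant 1/(C+1) bounds the distance by C/(C+1) times itself. *)
Lemma jac_inj s m (h : 'rV[R]_s -> 'rV[R]_m) p : real_analytic h ->
  \det (jac h p *m (jac h p)^T) != 0 ->
  exists2 d : R, 0 < d & forall x y, `|x - p| < d -> `|y - p| < d -> h x = h y -> x = y.
Proof.
move=> ha hdet; set J := jac h p in hdet.
have Ju : J *m J^T \in unitmx by rewrite unitmxE unitfE.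
have [C C0 HC] := mulmx_bounded (J^T *m invmx (J *m J^T)).
have e0 : 0 < (C + 1)^-1 by rewrite invr_gt0; lra.
have cJ i j : continuous (fun x => jac h x i j).
  by under eq_fun do rewrite mxE; exact: pd_continuous.
have [d d0 Hd] := strict_diff p (analytic_quad_diff ha) cJ e0.
exists d => // x y xd yd hxy.
have := Hd x y (ltW xd) (ltW yd); rewrite hxy subrr sub0r normrN -/J => Jyx.
have := HC ((y - x) *m J).
rewrite -mulmxA (mulmxA J) mulmxV// mulmx1 => yx.
have := le_trans yx (ler_wpM2l C0 Jyx); set z := `|y - x| => zz.
have z0 : z * (C + 1) <= C * z.
  by move: zz; rewrite mulrCA [X in _ <= X]mulrC ler_pdivlMr//; lra.
have : z <= 0 by lra.
by rewrite normr_le0 subr_eq0 => /eqP ->.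
Qed.

(** The minor forces [J *m U] to have rank [r], so its column space is all of that of [J];
    transposition turns this into an inclusion of row spaces. *)
Lemma rank_factor s n r (J : 'M[R]_(s, n)) (U : 'M[R]_(n, r)) (B : 'M[R]_(r, s)) :
  (\rank J <= r)%N -> \det (B *m J *m U) != 0 -> exists L, J = J *m U *m L.
Proof.
move=> Jr hdet.
have rBJU : \rank (B *m J *m U) = r.
  by apply: mxrank_unit; rewrite unitmxE unitfE.
have rJU : (\rank J^T <= \rank (J *m U)^T)%N.
  rewrite !mxrank_tr (leq_trans Jr)// -{1}rBJU -mulmxA; exact: mxrankM_maxr.
have JUJ : ((J *m U)^T <= J^T)%MS by rewrite trmx_mul submxMl.
have := geq_leqif (mxrank_leqif_sup JUJ); rewrite rJU => /esym /submxP[L JL].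
by exists L^T; rewrite -[LHS]trmxK JL trmx_mul trmxK.
Qed.

(** Up to invertible factors [J] is [pid_mx (\rank J)], and rectangular [pid_mx] matrices cut out
    its identity block. *)
Lemma rank_pivot s n (J : 'M[R]_(s, n)) :
  exists (B : 'M[R]_(\rank J, s)) (U : 'M[R]_(n, \rank J)), B *m J *m U = 1%:M.
Proof.
have := mulmx_ebase J; have := col_ebase_unit J; have := row_ebase_unit J.
move: (col_ebase J) (row_ebase J) => C D Du Cu JE.
have E : invmx C *m J *m invmx D = pid_mx (\rank J).
  by rewrite -[X in _ *m X *m _ = _]JE !mulmxA mulVmx// mul1mx mulmxK.
exists (pid_mx (\rank J) *m invmx C), (invmx D *m pid_mx (\rank J)).
transitivity ((pid_mx (\rank J) : 'M[R]_(\rank J, s)) *m (invmx C *m J *m invmx D) *m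
    (pid_mx (\rank J) : 'M[R]_(n, \rank J))); first by rewrite !mulmxA.
rewrite E !mul_pid_mx -pid_mx_1; congr pid_mx.
have := rank_leq_row J; have := rank_leq_col J => h1 h2.
by rewrite minnn (minn_idPr h2) minnn (minn_idPr h1).
Qed.

End Assembly.

Theorem theorem4 (R : realType) (s m n : nat) (A : set 'rV[R]_s)
    (h : 'rV[R]_s -> 'rV[R]_m) (f : 'rV[R]_m -> 'rV[R]_n) :
  borel_set A ->
  (0 < lebesgue_outer A)%E ->
  (s <= m)%N ->
  real_analytic h ->
  (exists v : 'rV[R]_s, Jac h v != 0) ->
  real_analytic f ->
  (forall y1 y2, (h @` A) y1 -> (h @` A) y2 -> f y1 = f y2 -> y1 = y2) ->
  (n >= s)%N.
Proof.
case: s A h => [//|s] A h bA A0 _ ha [v Jv] fa fA.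
rewrite leqNgt; apply/negP => ns.
pose J x := jac h x *m jac f (h x).
have lJh i j : line_analytic (fun x => jac h x i j).
  by under eq_fun do rewrite mxE; exact: pd_line_analytic.
have ch : continuous h by apply: row_continuous => i; exact: analytic_continuous.
(* Analyticity of [f \o h] is not established as such: [h] maps lines to analytic curves, which is
   enough for the entries of its differential. *)
have lJf i j : line_analytic (fun x => jac f (h x) i j).
  under eq_fun do rewrite mxE; split.
    by move=> x; apply: continuous_comp; [exact: ch|exact: pd_continuous].
  move=> x w; apply: (@pd_comp_analytic1 R m _ i (fun t => h (t *: w + x))) => // k.
  by have [_] := analytic_line_analytic (ha k); exact.
have lJ i j : line_analytic (fun x => J x i j) by exact: line_analytic_mulmx.
have gJ : quad_diff (f \o h) J.
  by apply: quad_diff_comp; exact: analytic_quad_diff.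
have [r [x1 rx1] rmax] : exists2 r, (exists x, \rank (J x) = r) &
    forall x, (\rank (J x) <= r)%N.
  pose Q k := `[< exists x, \rank (J x) = k >].
  have Qex : exists k, Q k by exists (\rank (J 0)); apply/asboolP; exists 0.
  have Qub k : Q k -> (k <= n)%N by move=> /asboolP[x <-]; exact: rank_leq_col.
  have [r /asboolP rx rm] := ex_maxnP Qex Qub; exists r => // x.
  by apply: rm; apply/asboolP; exists x.
have rs : (r < s.+1)%N by rewrite -rx1; exact: leq_ltn_trans (rank_leq_col _) ns.
have [B [U BU]] : exists (B : 'M[R]_(r, s.+1)) (U : 'M[R]_(n, r)), B *m J x1 *m U = 1%:M.
  by rewrite -rx1; exact: rank_pivot.
pose D x := \det (B *m J x *m U); pose E x := \det (jac h x *m (jac h x)^T).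
have lcst p q (M : 'M[R]_(p, q)) i j : line_analytic (fun _ : 'rV[R]_s.+1 => M i j).
  exact: line_analytic_cst.
have lD : line_analytic D.
  apply: line_analytic_det; apply: line_analytic_mulmx; last exact: lcst.
  by apply: line_analytic_mulmx; [exact: lcst|exact: lJ].
have lE : line_analytic E.
  apply: line_analytic_det; apply: line_analytic_mulmx => // i j.
  by under eq_fun do rewrite mxE; exact: lJh.
have D1 : D x1 != 0 by rewrite /D BU det1 oner_neq0.
have Ev : E v != 0.
  apply: contra Jv => /eqP Ev; rewrite /Jac Dmat_jac// trmxK.
  by rewrite -/(E v) Ev sqrtr0.
suff : lebesgue_outer A = 0%E by move=> AE; rewrite AE ltxx in A0.
apply: (@outer_null_subset _ _ _ (A `&` [set x | D x != 0 /\ E x != 0] `|`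
    ([set x | D x = 0] `|` [set x | E x = 0]))).
  move=> x Ax; have [Dx|Dx] := eqVneq (D x) 0; first by right; left; exact: Dx.
  have [Ex|Ex] := eqVneq (E x) 0; first by right; right; exact: Ex.
  by left; split; [exact: Ax|split; [exact: Dx|exact: Ex]].
apply: outer_null_setU; last first.
  by apply: outer_null_setU; [exact: zero_set_null lD D1|exact: zero_set_null lE Ev].
apply: outer_null_local => p [Dp Ep].
have [d1 d10 hinj] := jac_inj ha Ep.
have [d2 /= d20 Dd2] : exists2 d : R, 0 < d & forall x, `|x - p| < d -> D x != 0.
  have : nbhs p (D @^-1` [set y | y != 0]).
    apply: open_nbhs_nbhs; split=> //; apply: open_comp; last exact: open_neq.
    by move=> x _; exact: lD.1.
  move=> /nbhs_ballP[d d0 Hd]; exists d; first exact: d0.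
  by move=> x xd; apply: (Hd x); apply/rV_ballE.
have Dpu : B *m J p *m U \in unitmx by rewrite unitmxE unitfE.
(* [B] is a pivot at [x1]; the inverse factor normalises it at [p]. Below [d1] the map [h] is
   injective, below [d2] the minor stays nonzero. *)
apply: (@fibre_null R s n r (f \o h) J U (invmx (B *m J p *m U) *m B) p
  (Num.min d1 d2)) => //.
- by move=> i j; exact: (lJ i j).1.
- by rewrite -(mulmxA _ B) -(mulmxA _ (B *m J p)) mulVmx.
- by rewrite lt_min d10.
- move=> x; rewrite lt_min => /andP[_ /Dd2 Dx].
  by apply: rank_factor Dx; exact: rmax.
- move=> x y Ax Ay; rewrite !lt_min => /andP[xd _] /andP[yd _] fxy.
  apply: hinj => //; apply: fA fxy; [by exists x|by exists y].
Qed.
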